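(* Let $Q_t(n)$ be the number in system at time $t$ of an $M^n/G/\infty$ queue, i.e. an infinite server queue with stationary batch arrival rate $\lambda>0$, fixed arrival batch size $n\in\mathbb{Z}^+$, and general service distribution $G$. Then the steady-state number in system $Q_\infty(n)$ satisfies $$Q_\infty(n)\stackrel{D}{=}\sum_{j=1}^n (n-j+1)\,Y_j,$$ where $Y_1,\dots,Y_n$ are independent with $Y_j\sim\mathrm{Pois}\left(\lambda\,\mathbb{E}[S_{(j)}-S_{(j-1)}]\right)$, $S_{(1)}\le\dots\le S_{(n)}$ are the order statistics of an i.i.d. sample of size $n$ from $G$, and $S_{(0)}=0$.
   Context: Model: batches arrive at the epochs of a Poisson process of rate $\lambda$. Each batch brings exactly $n$ customers simultaneously. There are infinitely many servers, so every customer starts service immediately upon arrival and leaves when its service is complete. Service durations of all customers are i.i.d. nonnegative (finite) random variables with distribution $G$, independent of the arrival process. $Q_t(n)$ is the number of customers present at time $t$. $Q_\infty(n)$ denotes a random variable with the limiting distribution of $Q_t(n)$ as $t\to\infty$ (starting from an empty system). $\mathrm{Pois}(a)$ is the Poisson distribution with mean $a$, with $\mathrm{Pois}(0)$ the point mass at $0$. If $G$ has infinite mean, the identity is read in $\{0,1,2,\dots\}\cup\{\infty\}$, with $\mathrm{Pois}(\infty)$ the point mass at $\infty$; when $G$ has finite mean all quantities are finite. *)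

(* Defs.v *)
From HB Require Import structures.
From mathcomp Require Import all_boot all_order all_algebra.
From mathcomp Require Import all_classical all_reals all_analysis.
From mathcomp Require Import measurable_realfun.

Set Implicit Arguments.
Unset Strict Implicit.
Unset Printing Implicit Defensive.
Import Order.TTheory GRing.Theory Num.Theory.
Import numFieldNormedType.Exports.

Local Open Scope classical_set_scope.
Local Open Scope ring_scope.

(* Random counts take values in {0, 1, 2, ...} together with infinity, viewed
   as a closed subset of \bar R. *)

Definition has_law d d' (T : measurableType d) (U : measurableType d')
    (R : realType) (P : probability T R) (X : T -> U)
    (mu : set U -> \bar R) : Prop :=
  forall A : set U, measurable A -> P (X @^-1` A) = mu A.

Definition equal_in_law d d1 d2 (T1 : measurableType d1)
    (T2 : measurableType d2) (U : measurableType d) (R : realType)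
    (P1 : probability T1 R) (X1 : T1 -> U)
    (P2 : probability T2 R) (X2 : T2 -> U) : Prop :=
  forall A : set U, measurable A -> P1 (X1 @^-1` A) = P2 (X2 @^-1` A).

Definition mutually_independent d d' (T : measurableType d)
    (U : measurableType d') (R : realType) (P : probability T R)
    (I : eqType) (X : I -> T -> U) : Prop :=
  forall (J : seq I) (A : I -> set U),
    uniq J -> (forall i, measurable (A i)) ->
    P (\bigcap_(i in [set` J]) (X i @^-1` A i)) =
    (\prod_(i <- J) P (X i @^-1` A i))%E.

Definition process_sigma d (U : measurableType d) (T I : Type)
    (X : I -> T -> U) : set (set T) :=
  <<s \bigcup_i preimage_set_system setT (X i) measurable >>.

Definition independent_processes d d1 d2 (T : measurableType d)
    (U1 : measurableType d1) (U2 : measurableType d2) (R : realType)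
    (P : probability T R) (I1 I2 : Type)
    (X1 : I1 -> T -> U1) (X2 : I2 -> T -> U2) : Prop :=
  forall E F : set T, process_sigma X1 E -> process_sigma X2 F ->
    P (E `&` F) = (P E * P F)%E.

Definition iid d d' (T : measurableType d) (U : measurableType d')
    (R : realType) (P : probability T R) (I : eqType) (X : I -> T -> U)
    (mu : set U -> \bar R) : Prop :=
  mutually_independent P X /\ forall i, has_law P (X i) mu.

(* Weak convergence on \bar R: mass escaping to infinity converges to the
   point mass at +oo. *)
Definition cvg_in_law d d' (T : measurableType d) (T' : measurableType d')
    (R : realType) (P : probability T R) (X : R -> T -> \bar R)
    (P' : probability T' R) (Xoo : T' -> \bar R) : Prop :=
  forall f : \bar R -> R,
    continuous f -> [bounded f x | x in [set: \bar R]] ->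
    'E_P[f \o X t]%E @[t --> +oo%R] --> 'E_P'[f \o Xoo]%E.

(* The second argument of poisson_prob is a dummy; poisson_prob 0 is the point
   mass at 0.  Only a >= 0 is meaningful. *)
Definition Pois (R : realType) (a : \bar R) (A : set (\bar R)) : \bar R :=
  if a is r%:E then poisson_prob r 0 [set k : nat | A k%:R%:E]
  else \d_(+oo%E : \bar R) A.

Definition arrivals (R : realType) (T : Type) (tau : nat -> T -> R) (s t : R)
    (w : T) : \bar R :=
  counting [set k : nat | s < tau k w <= t].

(* tau k is the epoch of the (k+1)-st arrival after time 0. *)
Definition poisson_process d (T : measurableType d) (R : realType)
    (P : probability T R) (lambda : R) (tau : nat -> T -> R) : Prop :=
  [/\ \forall w \ae P, forall k, 0 < tau k w <= tau k.+1 w,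
      forall s t, 0 <= s -> s <= t ->
        has_law P (arrivals tau s t) (Pois (lambda * (t - s))%:E) &
      forall t : nat -> R, 0 <= t 0%N -> (forall i, t i <= t i.+1) ->
        mutually_independent P (fun i => arrivals tau (t i) (t i.+1)) ].

(* S (k, i) is the service duration of customer i of the batch arriving at
   tau k. *)
Record batch_queue d (T : measurableType d) (R : realType)
    (P : probability T R) (lambda : R) (n : nat) (G : probability R R)
    (tau : nat -> {RV P >-> R}) (S : nat * 'I_n -> {RV P >-> R}) : Prop :=
  BatchQueue {
    bq_arrivals : poisson_process P lambda (fun k => tau k : T -> R) ;
    bq_services : iid P (fun p => S p : T -> R) G ;
    bq_services_ge0 : G [set x | 0 <= x] = 1%E ;
    bq_independent : independent_processes P (fun k => tau k : T -> R)
                       (fun p => S p : T -> R) }.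

Definition number_in_system (R : realType) (T : Type) (n : nat)
    (tau : nat -> T -> R) (S : nat * 'I_n -> T -> R) (t : R) (w : T)
    : \bar R :=
  counting [set p : nat * 'I_n | tau p.1 w <= t < tau p.1 w + S p w].

(* S_(j) for 1 <= j <= n, with S_(0) = 0. *)
Definition order_stat (R : realType) (T : Type) (n : nat)
    (X : 'I_n -> T -> R) (j : nat) (w : T) : R :=
  if j is i.+1 then (sort <=%R [seq X k w | k : 'I_n])`_i else 0.

(* Main.v *)
Require Import Defs.
From HB Require Import structures.
From mathcomp Require Import all_boot all_order all_algebra.
From mathcomp Require Import finmap.
From mathcomp Require Import all_classical all_reals all_analysis.
From mathcomp Require Import measurable_realfun.
From mathcomp Require Import ring lra.

Set Implicit Arguments.
Unset Strict Implicit.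
Unset Printing Implicit Defensive.
Import Order.TTheory GRing.Theory Num.Theory.
Import numFieldNormedType.Exports.

Local Open Scope classical_set_scope.
Local Open Scope ring_scope.

(** Everything is decided by the generating functions E[z^Q], 0 < z < 1, with
    z^oo = 0.

    A batch that arrived at the epoch tau <= t still has each of its n
    customers present with probability 1 - G(t - tau), independently.  Given
    the arrival epochs, E[z^(Q_t)] is therefore the product over the arrivals
    of p(t - tau)^n, where p(u) = 1 - (1 - z) P(S > u) is [customer_pgf], and
    averaging over the Poisson arrivals should give
      E[z^(Q_t)] = exp (- lambda int_0^t (1 - p(u)^n) du).
    The integrand is [batch_loss].  Conditioning on a whole sequence of real
    epochs is avoided by monotonicity.  As p is nondecreasing, replacing the
    age t - tau of each batch by its extreme values over one of m equal slots
    of (0, t] bounds z^(Q_t) from both sides.  For a slotted system only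
    finitely many assignments of batches to slots have to be distinguished,
    so the independence of services and arrivals can be used event by event
    ([mean_slots]), and the slot counts are independent Poisson variables
    ([slots_limit]).  The two bounds are exponentials of the lower and upper
    Riemann sums of the same monotone integrand ([pgf_sandwich]), which
    differ by at most t / m ([riemann_error]).  Letting m and then t tend to
    infinity gives the limit exp (- lambda int_0^oo (1 - p(u)^n) du), to be
    read as 0 when the integral diverges ([pgf_limit]).

    Let N(u) be the number of sample variables exceeding u.  By independence
    1 - p(u)^n = E[1 - z^N(u)], and N(u) = n - j exactly when
    S_(j) <= u < S_(j+1).  Tonelli's theorem turns the integral over u into
      sum_(j < n) (1 - z^(n - j)) E[S_(j+1) - S_(j)]
    ([integral_batch_loss]), and minus lambda times this sum is the logarithm
    of the generating function of sum_(j < n) (n - j) Y_(j+1)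
    ([pgf_weighted_sum]).

    Convergence of generating functions implies weak convergence on
    {0, 1, 2, ...} with infinity ([cvg_in_law_pgf]), including the case where
    mass escapes to infinity, and the bounded continuous functions on the
    extended reals determine a law ([equal_in_law_continuous]), so that the
    limit law is unique. *)

(** * Bounded measurable functions and their means *)

Section bounded_measurable.
Context d (T : measurableType d) (R : realType).
Implicit Types (f g : T -> R) (P : probability T R).

Definition bounded_mfun f := measurable_fun setT f /\ exists M, forall x, `|f x| <= M.

Lemma bounded_mfun_cst r : bounded_mfun (fun=> r).
Proof. by split; [exact: measurable_cst | exists `|r|]. Qed.

Lemma bounded_mfunD f g : bounded_mfun f -> bounded_mfun g -> bounded_mfun (fun x => f x + g x).
Proof.
move=> [mf [M fM]] [mg [N gN]]; split; first exact: measurable_funD.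
by exists (M + N) => x; rewrite (le_trans (ler_normD _ _))// lerD.
Qed.

Lemma bounded_mfunM f g : bounded_mfun f -> bounded_mfun g -> bounded_mfun (fun x => f x * g x).
Proof.
move=> [mf [M fM]] [mg [N gN]]; split; first exact: measurable_funM.
by exists (M * N) => x; rewrite normrM ler_pM.
Qed.

Lemma bounded_mfunN f : bounded_mfun f -> bounded_mfun (fun x => - f x).
Proof.
move=> bf; rewrite (_ : (fun _ => _) = (fun x => -1 * f x)).
  exact: bounded_mfunM (bounded_mfun_cst _) bf.
by apply/funext => x; rewrite mulN1r.
Qed.

Lemma bounded_mfun_sum (I : Type) (s : seq I) (F : I -> T -> R) :
  (forall i, bounded_mfun (F i)) -> bounded_mfun (fun x => \sum_(i <- s) F i x).
Proof.
move=> bF; elim: s => [|i s IH].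
  by under eq_fun do rewrite big_nil; exact: bounded_mfun_cst.
by under eq_fun do rewrite big_cons; exact: bounded_mfunD.
Qed.

Lemma bounded_mfun_prod (I : Type) (s : seq I) (F : I -> T -> R) :
  (forall i, bounded_mfun (F i)) -> bounded_mfun (fun x => \prod_(i <- s) F i x).
Proof.
move=> bF; elim: s => [|i s IH].
  by under eq_fun do rewrite big_nil; exact: bounded_mfun_cst.
by under eq_fun do rewrite big_cons; exact: bounded_mfunM.
Qed.

Lemma bounded_mfun_indic (A : set T) : measurable A -> bounded_mfun (\1_A : T -> R).
Proof.
move=> mA; split; first exact: measurable_indic.
by exists 1 => x; rewrite indicE; case: (_ \in _); rewrite ?normr1 ?normr0.
Qed.

Lemma bounded_mfun_integrable P f : bounded_mfun f -> P.-integrable setT (EFin \o f).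
Proof.
move=> [mf [M fM]]; apply: measurable_bounded_integrable => //.
  by rewrite (le_lt_trans (probability_le1 _ _))// ltry.
exists M; split; first exact: num_real.
by move=> y My x _ /=; apply: (le_trans (fM x)); exact: ltW.
Qed.

Lemma bounded_mfun_expectation P f : bounded_mfun f -> ('E_P[f] = (\int[P]_x f x)%:E)%E.
Proof.
move=> bf; rewrite unlock /Rintegral fineK//.
exact: integrable_fin_num (bounded_mfun_integrable P bf).
Qed.

Lemma meanD P f g : bounded_mfun f -> bounded_mfun g ->
  \int[P]_x (f x + g x) = \int[P]_x f x + \int[P]_x g x.
Proof. by move=> bf bg; rewrite RintegralD//; exact: bounded_mfun_integrable. Qed.

Lemma meanZ P f r : bounded_mfun f -> \int[P]_x (r * f x) = r * \int[P]_x f x.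
Proof. by move=> bf; rewrite RintegralZl//; exact: bounded_mfun_integrable. Qed.

Lemma meanB P f g : bounded_mfun f -> bounded_mfun g ->
  \int[P]_x (f x - g x) = \int[P]_x f x - \int[P]_x g x.
Proof. by move=> bf bg; rewrite RintegralB//; exact: bounded_mfun_integrable. Qed.

Lemma mean_cst P r : \int[P]_x r = r.
Proof. by rewrite Rintegral_cst// [X in fine X]probability_setT/= mulr1. Qed.

Lemma mean_sum P (I : Type) (s : seq I) (F : I -> T -> R) :
  (forall i, bounded_mfun (F i)) ->
  \int[P]_x (\sum_(i <- s) F i x) = \sum_(i <- s) \int[P]_x F i x.
Proof.
move=> bF; elim: s => [|i s IH].
  by under eq_Rintegral do rewrite big_nil; rewrite big_nil mean_cst.
under eq_Rintegral do rewrite big_cons.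
by rewrite big_cons meanD ?IH//; exact: bounded_mfun_sum.
Qed.

Lemma mean_indic P (A : set T) : measurable A -> \int[P]_x \1_A x = fine (P A).
Proof. by move=> mA; rewrite /Rintegral integral_indic// setIT. Qed.

Lemma mean_ae_eq P f g : measurable_fun setT f -> measurable_fun setT g ->
  (\forall x \ae P, f x = g x) -> \int[P]_x f x = \int[P]_x g x.
Proof.
move=> mf mg fg; rewrite /Rintegral; congr fine.
apply: ae_eq_integral => //; try exact/measurable_EFinP.
by apply: filterS fg => x /= -> _.
Qed.

Lemma mean_le P f g : bounded_mfun f -> bounded_mfun g -> (\forall x \ae P, f x <= g x) ->
  \int[P]_x f x <= \int[P]_x g x.
Proof.
move=> bf bg fg.
have bm : bounded_mfun (fun x => Num.max (f x) (g x)).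
  case: bf bg => [mf [M fM]] [mg [N gN]]; split; first exact: measurable_maxr.
  exists (Num.max M N) => x; rewrite le_max.
  by case: (leP (f x) (g x)) => _; rewrite ?fM ?gN ?orbT.
rewrite (@mean_ae_eq P g (fun x => Num.max (f x) (g x))).
- apply: le_Rintegral => //; try exact: bounded_mfun_integrable.
  by move=> x _; rewrite le_max lexx.
- exact: bg.1.
- exact: bm.1.
- by apply: filterS fg => x /max_r.
Qed.

Lemma mean_norm_le P f M : bounded_mfun f -> (\forall x \ae P, `|f x| <= M) ->
  `|\int[P]_x f x| <= M.
Proof.
move=> bf fM; rewrite ler_norml; apply/andP; split.
- rewrite -(mean_cst P (- M)); apply: mean_le => //; first exact: bounded_mfun_cst.
  by apply: filterS fM => x; rewrite ler_norml => /andP[].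
- rewrite -[leRHS](mean_cst P); apply: mean_le => //; first exact: bounded_mfun_cst.
  by apply: filterS fM => x; rewrite ler_norml => /andP[].
Qed.

Lemma mean_cvg P (F : nat -> T -> R) f M : (forall n, measurable_fun setT (F n)) ->
  measurable_fun setT f -> (forall n x, `|F n x| <= M) ->
  (\forall x \ae P, F n x @[n --> \oo] --> f x) ->
  \int[P]_x F n x @[n --> \oo] --> \int[P]_x f x.
Proof.
move=> mF mf FM Ff.
have bF n : bounded_mfun (F n) by split => //; exists M => x; exact: FM.
have mF' n : measurable_fun setT (EFin \o F n) by exact/measurable_EFinP.
have mf' : measurable_fun setT (EFin \o f) by exact/measurable_EFinP.
have iM : P.-integrable setT (EFin \o (fun=> M)).
  exact: bounded_mfun_integrable (bounded_mfun_cst _).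
have Ff' : {ae P, forall x, setT x -> (EFin \o F n) x @[n --> \oo] --> (EFin \o f) x}.
  by apply: filterS Ff => x /= Ffx _; apply: cvg_EFin => //; exact: nearW.
have [] := dominated_convergence measurableT mF' mf' Ff' iM.
  by apply: aeW => x n _ /=; rewrite lee_fin FM.
move=> if_ _ /= cv; apply: fine_cvg.
by rewrite fineK//; exact: integrable_fin_num if_.
Qed.

End bounded_measurable.

Lemma bounded_mfun_comp d1 d2 (T : measurableType d1) (U : measurableType d2)
  (R : realType) (f : U -> R) (X : T -> U) :
  measurable_fun setT X -> bounded_mfun f -> bounded_mfun (f \o X).
Proof.
move=> mX [mf [M fM]]; split; first exact: measurableT_comp.
by exists M => x; exact: fM.
Qed.

(** * Means of products of independent variables *)

Section replacement.
Context d1 d2 (T : measurableType d1) (U : measurableType d2) (R : realType).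
Variables (P : probability T R).

Import HBNNSimple.

(** One factor of a product rule is extended from indicators to functions at a
    time: both sides are linear in [g] and pass to the limit along simple
    functions increasing to [g]. *)
Lemma mean_indic_to_fun (W : T -> R) (X : T -> U) (c : R) (g : U -> R) :
  bounded_mfun W -> measurable_fun setT X -> bounded_mfun g -> (forall u, 0 <= g u) ->
  (forall A, measurable A ->
     \int[P]_w (W w * \1_A (X w)) = c * \int[P]_w \1_A (X w)) ->
  \int[P]_w (W w * g (X w)) = c * \int[P]_w g (X w).
Proof.
move=> bW mX bg g0 WA.
have [mg [M gM]] := bg.
have mg' : measurable_fun setT (EFin \o g) by exact/measurable_EFinP.
have g0' u : setT u -> (0 <= (EFin \o g) u)%E by rewrite lee_fin.
pose G n : {nnsfun U >-> R} := nnsfun_approx measurableT mg' n.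
have GM n u : `|G n u| <= M.
  rewrite ger0_norm// (le_trans _ (gM u))// ger0_norm//.
  by have := @le_approx _ _ _ setT (EFin \o g) n u g0' I; rewrite -nnsfun_approxE lee_fin.
have bG n : bounded_mfun (G n : U -> R) by split => //; exists M => u; exact: GM.
have bI (A : set U) : measurable A -> bounded_mfun (fun w => \1_A (X w) : R).
  by move=> mA; exact: bounded_mfun_comp mX (bounded_mfun_indic R mA).
have Ggcvg u : G n u @[n --> \oo] --> g u.
  exact: (fine_cvg (cvg_nnsfun_approx measurableT mg' g0' (x := u) I)).
have EG n : \int[P]_w (W w * G n (X w)) = c * \int[P]_w G n (X w).
  have GE u : G n u = \sum_(y <- finmap.enum_fset (fset_set (range (G n))))
     y * \1_(G n @^-1` [set y]) u by rewrite fimfunE fsbig_finite.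
  have mGy y : measurable (G n @^-1` [set y]) by exact: measurable_funPTI.
  under eq_Rintegral do rewrite GE big_distrr/=.
  under [in RHS]eq_Rintegral do rewrite GE.
  have b1 y : bounded_mfun (fun w => y * \1_(G n @^-1` [set y]) (X w)).
    exact: bounded_mfunM (bounded_mfun_cst _ _) (bI _ (mGy y)).
  rewrite mean_sum; last by move=> y; exact: bounded_mfunM bW (b1 y).
  rewrite mean_sum//.
  rewrite big_distrr/=; apply: eq_bigr => y _.
  under eq_Rintegral do rewrite mulrCA.
  rewrite (@meanZ _ _ _ P (fun w => W w * \1_(G n @^-1` [set y]) (X w)));
    last by exact: bounded_mfunM bW (bI _ (mGy y)).
  rewrite meanZ; last exact: bI.
  by rewrite WA// mulrCA.
have mW := bW.1; have [N WN] := bW.2.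
have c1 : \int[P]_w (W w * G n (X w)) @[n --> \oo] --> \int[P]_w (W w * g (X w)).
  apply: (@mean_cvg _ _ _ _ _ _ (N * M)).
  - by move=> n; apply: measurable_funM => //; exact: measurableT_comp.
  - by apply: measurable_funM => //; exact: measurableT_comp.
  - by move=> n w; rewrite normrM ler_pM.
  - by apply: aeW => w; apply: cvgM; [exact: cvg_cst|exact: Ggcvg].
have c2 : c * \int[P]_w (G n (X w)) @[n --> \oo] --> c * \int[P]_w g (X w).
  apply: cvgM; first exact: cvg_cst.
  apply: (@mean_cvg _ _ _ _ _ _ M) => //.
  - by move=> n; exact: measurableT_comp.
  - exact: measurableT_comp.
  - by apply: aeW => w; exact: Ggcvg.
by rewrite -(cvg_lim _ c1)// -(cvg_lim _ c2)//; congr (limn _); apply/funext.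
Qed.

End replacement.

Lemma prod_indic_preimage (R : realType) (T U : Type) (I : eqType) (X : I -> T -> U)
  (J : seq I) (A : I -> set U) (w : T) :
  \prod_(i <- J) \1_(A i) (X i w) =
  \1_(\bigcap_(i in [set` J]) (X i @^-1` A i)) w :> R.
Proof.
have [h|/existsNP[i /not_implyP[iJ nAi]]] :=
    pselect (forall i, i \in J -> A i (X i w)).
  rewrite [RHS]indicE mem_set//= big_seq big1// => i iJ.
  by rewrite indicE mem_set//; exact: h.
rewrite [RHS]indicE memNset//=; last by move=> /(_ i iJ).
apply/eqP; rewrite prodf_seq_eq0; apply/hasP; exists i => //=.
by rewrite indicE memNset.
Qed.

Lemma fine_prode (R : realType) (I : Type) (s : seq I) (F : I -> \bar R) :
  (forall i, F i \is a fin_num) ->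
  fine (\prod_(i <- s) F i)%E = \prod_(i <- s) fine (F i).
Proof.
move=> Ff; suff -> : (\prod_(i <- s) F i)%E = (\prod_(i <- s) fine (F i))%:E by [].
elim: s => [|i s IH]; first by rewrite !big_nil.
by rewrite !big_cons IH EFinM fineK.
Qed.

Section product_rule.
Context d1 d2 (T : measurableType d1) (U : measurableType d2) (R : realType).
Variables (P : probability T R) (I : eqType) (X : I -> T -> U) (E : set T).
Hypotheses (mX : forall i, measurable_fun setT (X i)) (mE : measurable E).
Hypothesis indepE : forall (J : seq I) (A : I -> set U),
  uniq J -> (forall i, measurable (A i)) ->
  P (E `&` \bigcap_(i in [set` J]) (X i @^-1` A i)) =
  (P E * \prod_(i <- J) P (X i @^-1` A i))%E.

(** The event [E] is a factor of its own, so that the same statement serves for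
    mutually independent variables ([E] the whole space) and for variables that
    are moreover independent of an event. *)
Lemma mean_prod_indep (J : seq I) (f : I -> U -> R) : uniq J ->
  (forall i, bounded_mfun (f i)) -> (forall i u, 0 <= f i u) ->
  \int[P]_w (\1_E w * \prod_(i <- J) f i (X i w)) =
  fine (P E) * \prod_(i <- J) \int[P]_w f i (X i w).
Proof.
move=> uJ bf f0.
have mXA i (A : set U) : measurable A -> measurable (X i @^-1` A).
  by move=> mA; rewrite -[X in measurable X]setTI; exact: mX.
have bI i (A : set U) : measurable A -> bounded_mfun (fun w => \1_A (X i w) : R).
  by move=> mA; exact: bounded_mfun_comp (mX i) (bounded_mfun_indic R mA).
have bfX i : bounded_mfun (fun w => f i (X i w)) by exact: bounded_mfun_comp.
(* the factors in [J1] are functions, those in [J2] still indicators; the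
   induction moves an index from [J1] to [J2] *)
suff main (J1 J2 : seq I) (A : I -> set U) : uniq (J1 ++ J2) ->
    (forall i, measurable (A i)) ->
    \int[P]_w (\1_E w * ((\prod_(i <- J1) f i (X i w)) *
                         \prod_(i <- J2) \1_(A i) (X i w))) =
    fine (P E) * ((\prod_(i <- J1) \int[P]_w f i (X i w)) *
                  \prod_(i <- J2) \int[P]_w \1_(A i) (X i w)).
  have := main J [::] (fun=> setT); rewrite cats0 => /(_ uJ (fun=> measurableT)).
  by rewrite big_nil mulr1 => <-; apply: eq_Rintegral => w _; rewrite big_nil mulr1.
elim: J1 J2 A => [|i J1 IH] J2 A uJJ mA.
  rewrite big_nil mul1r.
  rewrite (_ : (fun w => _) =
      \1_(E `&` \bigcap_(i in [set` J2]) (X i @^-1` A i))); last first.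
    by apply/funext => w; rewrite big_nil mul1r indicI/= prod_indic_preimage.
  have mcap : measurable (\bigcap_(i in [set` J2]) (X i @^-1` A i)).
    by apply: fin_bigcap_measurable => // i _; exact: mXA.
  rewrite mean_indic; last exact: measurableI.
  rewrite indepE// fineM ?fin_num_measure//; last first.
    by apply: prode_fin_num => i _; rewrite fin_num_measure//; exact: mXA.
  rewrite fine_prode; last by move=> i; rewrite fin_num_measure//; exact: mXA.
  congr (_ * _); apply: eq_bigr => i _.
  rewrite -(mean_indic P (mXA i _ (mA i))); exact: eq_Rintegral.
pose W w := \1_E w * ((\prod_(j <- J1) f j (X j w)) *
                       \prod_(j <- J2) \1_(A j) (X j w)) : R.
pose c := fine (P E) * ((\prod_(j <- J1) \int[P]_w f j (X j w)) *
                  \prod_(j <- J2) \int[P]_w \1_(A j) (X j w)).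
have bW : bounded_mfun W.
  apply: bounded_mfunM; first exact: bounded_mfun_indic.
  by apply: bounded_mfunM; apply: bounded_mfun_prod => // j; exact: bI.
transitivity (\int[P]_w (W w * f i (X i w))).
  by apply: eq_Rintegral => w _; rewrite big_cons /W; ring.
rewrite (mean_indic_to_fun (c := c))//; last first.
  move=> B mB.
  pose A' j := if j == i then B else A j.
  have mA' j : measurable (A' j) by rewrite /A'; case: ifP.
  have iJ2 : i \notin J2.
    by move: uJJ => /=; rewrite mem_cat negb_or => /andP[/andP[]].
  have uJ' : uniq (J1 ++ i :: J2).
    by rewrite -(@perm_uniq _ ((i :: J1) ++ J2))// perm_sym -cat1s perm_catCA.
  have A'E j : j \in J2 -> A' j = A j.
    by rewrite /A'; case: eqP => // ->; rewrite (negbTE iJ2).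
  have A'i : A' i = B by rewrite /A' eqxx.
  have pA' : \prod_(j <- J2) \int[P]_w \1_(A' j) (X j w) =
      \prod_(j <- J2) \int[P]_w (\1_(A j) (X j w) : R).
    by apply: eq_big_seq => j jJ2; rewrite A'E.
  have := IH (i :: J2) A' uJ' mA'; rewrite big_cons A'i pA' => IHB.
  transitivity (fine (P E) * (\prod_(i0 <- J1) \int[P]_w f i0 (X i0 w) *
     ((\int[P]_w \1_B (X i w)) * \prod_(j <- J2) \int[P]_w \1_(A j) (X j w)))).
    rewrite -IHB; apply: eq_Rintegral => w _; rewrite big_cons A'i /W.
    have -> : \prod_(j <- J2) \1_(A' j) (X j w) =
              \prod_(j <- J2) (\1_(A j) (X j w) : R).
      by apply: eq_big_seq => j jJ2; rewrite A'E.
    by ring.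
  by rewrite /c; ring.
by rewrite big_cons /c; ring.
Qed.

End product_rule.

(** * Generating functions and weak convergence *)

Section ereal_functions.
Context {R : realType}.

Lemma measurable_fun_ereal d (U : measurableType d) (f : \bar R -> U) :
  measurable_fun setT (f \o EFin) -> measurable_fun setT f.
Proof.
move=> mf _ Y mY; rewrite setTI.
have m1 x : measurable (f @^-1` Y `&` [set x]).
  have [fx|fx] := pselect (Y (f x)).
    by rewrite setIidr// => _ ->.
  rewrite (_ : _ `&` _ = set0)//.
  by apply/seteqP; split => // y [/= Yfy yx]; apply: fx; rewrite -yx.
have -> : f @^-1` Y = EFin @` ((f \o EFin) @^-1` Y) `|`
    (f @^-1` Y `&` [set -oo%E]) `|` (f @^-1` Y `&` [set +oo%E]).
  apply/seteqP; split => [[r| |] Yf|x [[[r Yr <-]|[]]|[]]]//.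
  - by left; left; exists r.
  - by right.
  - by left; right.
apply: measurableU => //; apply: measurableU => //.
by apply: measurable_image_EFin; have := mf measurableT _ mY; rewrite setTI.
Qed.

Lemma continuous_ereal_measurable (f : \bar R -> R) :
  continuous f -> measurable_fun setT f.
Proof.
move=> cf; apply: measurable_fun_ereal; apply: continuous_measurable_fun => r.
by apply: continuous_comp; [by apply: cvg_EFin; [exact: nearW|exact: cvg_id]|exact: cf].
Qed.

Lemma continuous_contract : continuous (@contract R).
Proof.
move=> x; apply/cvgrPdist_lt => e e0.
have := nbhsx_ballx x _ e0; exact: filterS.
Qed.

Definition natinf (x : \bar R) := x = +oo%E \/ exists k : nat, x = k%:R%:E.

(** The weight z^x of a generating function, with z^oo = 0.  Only counts matter;
    truncating at 0 makes the function bounded on all of [\bar R] when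
    0 <= z <= 1. *)
Definition epow (z : R) (x : \bar R) : R :=
  if x is +oo%E then 0 else z `^ (Num.max (fine x) 0).

Lemma epow_nat z k : 0 <= z -> epow z k%:R%:E = z ^+ k.
Proof. by move=> z0; rewrite /epow/= max_l// powR_mulrn. Qed.

Lemma epow_ge0 z x : 0 <= epow z x.
Proof. by case: x => [r| |] //=; exact: powR_ge0. Qed.

Lemma epow_le1 z x : 0 <= z <= 1 -> epow z x <= 1.
Proof.
move=> /andP[z0 z1]; case: x => [r| |] //=; last by rewrite max_r// powRr0.
rewrite (_ : 1 = 1 `^ Num.max r 0); last by rewrite powR1.
by apply: ge0_ler_powR => //; rewrite ?nnegrE// le_max lexx orbT.
Qed.

Lemma bounded_mfun_epow z : 0 <= z <= 1 -> bounded_mfun (epow z).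
Proof.
move=> z01; split; last first.
  by exists 1 => x; rewrite ger0_norm ?epow_ge0// epow_le1.
apply: measurable_fun_ereal => /=.
apply: (@measurableT_comp _ _ _ _ _ _ (powR z)); first exact: measurable_powRr.
by apply: measurable_maxr; [exact: measurable_id|exact: measurable_cst].
Qed.

End ereal_functions.

Section weak_convergence.
Context d d2 (T : measurableType d) (T2 : measurableType d2) (R : realType).
Variables (P : probability T R) (P2 : probability T2 R).
Variables (Q : R -> T -> \bar R) (Z : T2 -> \bar R).
Hypotheses (mQ : forall t, measurable_fun setT (Q t)) (mZ : measurable_fun setT Z).
Hypotheses (nQ : forall t w, natinf (Q t w)) (nZ : \forall w \ae P2, natinf (Z w)).


Let cv (g : \bar R -> R) :=
  \int[P]_w g (Q t w) @[t --> +oo] --> \int[P2]_w g (Z w).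

Let bQ t (g : \bar R -> R) : bounded_mfun g -> bounded_mfun (fun w => g (Q t w)).
Proof. exact: bounded_mfun_comp. Qed.

Let bZ (g : \bar R -> R) : bounded_mfun g -> bounded_mfun (fun w => g (Z w)).
Proof. exact: bounded_mfun_comp. Qed.

Let cv_lin (g h : \bar R -> R) c : bounded_mfun g -> bounded_mfun h -> cv g -> cv h ->
  cv (fun x => g x + c * h x).
Proof.
move=> bg bh cg ch; rewrite /cv.
rewrite meanD; [|exact: bZ|by apply: (bounded_mfunM (bounded_mfun_cst _ _)); exact: bZ].
rewrite meanZ; last exact: bZ.
under eq_fun => t.
  rewrite meanD; [|exact: bQ|by apply: (bounded_mfunM (bounded_mfun_cst _ _)); exact: bQ].
  rewrite meanZ; last exact: bQ.
  over.
by apply: cvgD => //; apply: cvgM => //; exact: cvg_cst.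
Qed.

Let cv_cst c : cv (fun=> c).
Proof. by rewrite /cv !mean_cst; exact: cvg_cst. Qed.

Let cv_sum (s : seq nat) (g : nat -> \bar R -> R) (c : nat -> R) :
  (forall k, bounded_mfun (g k)) -> (forall k, k \in s -> cv (g k)) ->
  cv (fun x => \sum_(k <- s) c k * g k x).
Proof.
move=> bg; elim: s => [|k s IH] cg.
  by under eq_fun do rewrite big_nil; exact: cv_cst.
under eq_fun do rewrite big_cons addrC.
apply: (@cv_lin (fun x => \sum_(j <- s) c j * g j x) (g k) (c k)) => //.
- by apply: bounded_mfun_sum => j; exact: (bounded_mfunM (bounded_mfun_cst _ _)).
- by apply: IH => j js; apply: cg; rewrite inE js orbT.
- by apply: cg; rewrite inE eqxx.
Qed.

(** The functions whose means converge are closed under uniform limits, where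
    uniformity is only needed on the values that the variables can take. *)
Let cv_unif (g : \bar R -> R) : bounded_mfun g ->
  (forall e, 0 < e -> exists g', [/\ bounded_mfun g', cv g' &
      forall x, natinf x -> `|g x - g' x| <= e]) -> cv g.
Proof.
move=> bg H; apply/cvgrPdist_lt => e e0.
have [g' [bg' cg' gg']] := H (e / 3) ltac:(by rewrite divr_gt0).
move/cvgrPdist_lt: cg' => /(_ (e / 3)); rewrite divr_gt0// => /(_ isT).
apply: filterS => t dt.
have h1 : `|\int[P]_w g (Q t w) - \int[P]_w g' (Q t w)| <= e / 3.
  rewrite -meanB; [|exact: bQ..].
  apply: mean_norm_le; last by apply: aeW => w; exact: gg'.
  by apply: bounded_mfunD; [exact: bQ|apply: bounded_mfunN; exact: bQ].
have h2 : `|\int[P2]_w g (Z w) - \int[P2]_w g' (Z w)| <= e / 3.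
  rewrite -meanB; [|exact: bZ..].
  apply: mean_norm_le; last by apply: filterS nZ => w; exact: gg'.
  by apply: bounded_mfunD; [exact: bZ|apply: bounded_mfunN; exact: bZ].
rewrite distrC in h1.
rewrite (_ : _ - _ = (\int[P2]_w g (Z w) - \int[P2]_w g' (Z w)) +
  (\int[P2]_w g' (Z w) - \int[P]_w g' (Q t w)) +
  (\int[P]_w g' (Q t w) - \int[P]_w g (Q t w))); last by ring.
apply: (le_lt_trans (ler_normD _ _)).
apply: (le_lt_trans (lerD (ler_normD _ _) (lexx _))).
lra.
Qed.

Hypothesis Hz : forall z, 0 < z < 1 -> cv (epow z).

Let bpt k : bounded_mfun (\1_[set k%:R%:E] : \bar R -> R).
Proof. exact: bounded_mfun_indic. Qed.

Let indic_nat k j : \1_[set k%:R%:E] (j%:R%:E : \bar R) = (k == j)%:R :> R.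
Proof.
rewrite indicE; congr ((nat_of_bool _)%:R); apply/idP/eqP => [|->].
  by rewrite inE/= => -[] /eqP; rewrite eqr_nat => /eqP.
by rewrite inE.
Qed.

Let indic_inf k : \1_[set k%:R%:E] (+oo%E : \bar R) = 0 :> R.
Proof. by rewrite indicE memNset. Qed.

(** On the counts outside 0, ..., k - 1 the function z^(x - k) is within z of the
    indicator of k, and the contributions of 0, ..., k - 1 can be subtracted by
    induction; z may be taken as small as desired. *)
Let cv_point k : cv (\1_[set k%:R%:E]).
Proof.
elim/ltn_ind: k => k IH; apply: cv_unif => // e e0.
pose z := Num.min e (1/2).
have z01 : 0 < z < 1 by rewrite /z lt_min e0/= gt_min; apply/andP; split; lra.
have zk0 : z ^+ k != 0 by rewrite expf_neq0// gt_eqF//; case/andP: z01.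
exists (fun x => (\sum_(j <- iota 0 k) (- z ^+ j / z ^+ k) * \1_[set j%:R%:E] x) +
  (z ^+ k)^-1 * epow z x); split.
- apply: bounded_mfunD.
    by apply: bounded_mfun_sum => j; exact: (bounded_mfunM (bounded_mfun_cst _ _)).
  apply: (bounded_mfunM (bounded_mfun_cst _ _)); apply: bounded_mfun_epow.
  by case/andP: z01 => /ltW-> /ltW.
- apply: (@cv_lin
     (fun x => \sum_(j <- iota 0 k) (- z ^+ j / z ^+ k) * \1_[set j%:R%:E] x)).
  + by apply: bounded_mfun_sum => j; exact: (bounded_mfunM (bounded_mfun_cst _ _)).
  + by apply: bounded_mfun_epow; case/andP: z01 => /ltW-> /ltW.
  + by apply: cv_sum => // j; rewrite mem_iota => /andP[_ jk]; exact: IH.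
  + exact: Hz.
have [z0 z1] := andP z01.
have zle : z <= e by rewrite /z ge_min lexx.
move=> x [->|[i ->]].
  rewrite indic_inf big1 => [|j _]; last by rewrite indic_inf mulr0.
  by rewrite /epow mulr0 addr0 subrr normr0 ltW.
rewrite indic_nat epow_nat ?(ltW z0)//.
under eq_bigr do rewrite indic_nat.
have [ik|ki|->] := ltngtP i k.
- rewrite (bigD1_seq i) ?iota_uniq ?mem_iota//= eqxx mulr1 big1 ?addr0; last first.
    by move=> j /negbTE ->; rewrite mulr0.
  by rewrite /= (_ : _ - _ = 0) ?normr0 ?ltW//; ring.
- rewrite big_seq big1 ?add0r => [|j]; last first.
    by rewrite mem_iota add0n => /andP[_ jk]; rewrite ltn_eqF ?mulr0// (ltn_trans jk).
  rewrite normrN ger0_norm; last first.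
    by rewrite mulr_ge0 ?invr_ge0 ?exprn_ge0// ltW.
  have -> : i = (k + (i - k).-1.+1)%N by rewrite prednK ?subn_gt0// subnKC// ltnW.
  rewrite exprD mulKf// exprS (le_trans _ zle)// ler_piMr ?(ltW z0)//.
  by rewrite exprn_ile1// ltW.
- rewrite big_seq big1 ?add0r => [|j]; last first.
    by rewrite mem_iota add0n => /andP[_ jk]; rewrite ltn_eqF ?mulr0.
  by rewrite mulVf//= subrr normr0 ltW.
Qed.

(** A function continuous at infinity is, on the counts, uniformly close to its
    value there corrected at finitely many points. *)
Lemma cvg_in_law_pgf : cvg_in_law P Q P2 Z.
Proof.
move=> f cf bdf.
have bf : bounded_mfun f.
  split; first exact: continuous_ereal_measurable.
  have [M [_ /(_ (M + 1))]] := bdf; rewrite ltrDl ltr01 => /(_ isT) fM.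
  by exists (M + 1) => x; exact: fM.
have cvf : cv f; last first.
  rewrite (_ : 'E_P2[f \o Z]%E = (\int[P2]_w f (Z w))%:E); last first.
    by rewrite bounded_mfun_expectation//; exact: bZ.
  rewrite (_ : (fun t => 'E_P[f \o Q t]%E) = (fun t => (\int[P]_w f (Q t w))%:E)); last first.
    by apply/funext => t; rewrite bounded_mfun_expectation//; exact: bQ.
  by apply: cvg_EFin; [exact: nearW|exact: cvf].
apply: cv_unif => // e e0.
have fcvg : f k%:R%:E @[k --> \oo] --> f +oo%E.
  have ny : (k%:R%:E : \bar R) @[k --> \oo] --> +oo%E.
    by apply/cvgeryP; exact: cvgr_idn.
  exact: (cvg_comp _ _ ny (cf +oo%E)).
move/cvgrPdist_le: fcvg => /(_ e e0)[K _ HK].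
exists (fun x => f +oo%E +
  1 * \sum_(k <- iota 0 K) (f k%:R%:E - f +oo%E) * \1_[set k%:R%:E] x); split.
- apply: bounded_mfunD; first exact: bounded_mfun_cst.
  apply: (bounded_mfunM (bounded_mfun_cst _ _)).
  by apply: bounded_mfun_sum => j; exact: (bounded_mfunM (bounded_mfun_cst _ _)).
- apply: (@cv_lin (fun=> f +oo%E) (fun x =>
     \sum_(k <- iota 0 K) (f k%:R%:E - f +oo%E) * \1_[set k%:R%:E] x)).
  + exact: bounded_mfun_cst.
  + by apply: bounded_mfun_sum => j; exact: (bounded_mfunM (bounded_mfun_cst _ _)).
  + exact: cv_cst.
  + exact: cv_sum.
move=> x [->|[i ->]]; rewrite mul1r.
  rewrite big1 => [|j _]; last by rewrite indic_inf mulr0.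
  by rewrite addr0 subrr normr0 ltW.
under eq_bigr do rewrite indic_nat.
have [iK|Ki] := ltnP i K.
  rewrite (bigD1_seq i) ?iota_uniq ?mem_iota//= eqxx mulr1 big1 ?addr0; last first.
    by move=> j /negbTE ->; rewrite mulr0.
  by rewrite (_ : _ - _ = 0) ?normr0 ?ltW//; ring.
rewrite big_seq big1 ?addr0 => [|j]; last first.
  by rewrite mem_iota add0n => /andP[_ jk]; rewrite ltn_eqF ?mulr0// (leq_trans jk).
by rewrite distrC; exact: HK.
Qed.

End weak_convergence.

(** * Laws on the extended reals *)

Lemma probability_ereal_unique (R : realType) (m1 m2 : probability (\bar R) R) :
  (forall r : R, m1 `]r%:E, +oo[%classic = m2 `]r%:E, +oo[%classic) ->
  forall A, measurable A -> m1 A = m2 A.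
Proof.
move=> m12.
(* the whole space is added to the rays because no countable union of them
   contains -oo *)
pose G := [set A : set (\bar R) | A = setT \/ exists r : R, A = `]r%:E, +oo[%classic].
apply: (measure_unique G (fun=> setT)).
- apply/seteqP; split.
    rewrite [X in X `<=` _](ErealGenOInfty.measurableE R).
    by apply: sub_smallest2r; [exact: smallest_sigma_algebra|move=> _ [r ->]; right; exists r].
  apply: smallest_sub; first exact: sigma_algebra_measurable.
  by move=> _ [->|[r ->]]; [exact: measurableT|exact: emeasurable_itv].
- move=> _ _ [->|[r ->]] [->|[s ->]].
  + by left; rewrite setTI.
  + by right; exists s; rewrite setTI.
  + by right; exists r; rewrite setIT.
  + right; exists (Num.max r s); apply/seteqP; split => x /=.
      by rewrite !in_itv/= !andbT EFin_max gt_max => -[-> ->].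
    by rewrite !in_itv/= !andbT EFin_max gt_max => /andP[-> ->].
- by move=> i; left.
- by apply/seteqP; split => // x _; exists 0%N.
- move=> _ [->|[r ->]]; last exact: m12.
  exact: (etrans (probability_setT m1) (esym (probability_setT m2))).
- by move=> k; rewrite -ge0_fin_numE// fin_num_measure.
Qed.

(** Indicators of rays are increasing limits of continuous functions, built from
    [contract], the homeomorphism of [\bar R] onto [-1, 1]. *)
Lemma equal_in_law_continuous d1 d2 (T1 : measurableType d1)
  (T2 : measurableType d2) (R : realType) (P1 : probability T1 R)
  (P2 : probability T2 R) (X1 : T1 -> \bar R) (X2 : T2 -> \bar R) :
  measurable_fun setT X1 -> measurable_fun setT X2 ->
  (forall f : \bar R -> R, continuous f -> (forall x, 0 <= f x <= 1) ->
    \int[P1]_w f (X1 w) = \int[P2]_w f (X2 w)) ->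
  equal_in_law P1 X1 P2 X2.
Proof.
move=> mX1 mX2 H.
pose Y1 : {mfun T1 >-> \bar R} := HB.pack X1 (isMeasurableFun.Build _ _ _ _ X1 mX1).
pose Y2 : {mfun T2 >-> \bar R} := HB.pack X2 (isMeasurableFun.Build _ _ _ _ X2 mX2).
move=> A mA.
apply: (@probability_ereal_unique R (distribution P1 Y1) (distribution P2 Y2)) => // r.
set B := `]r%:E, +oo[%classic : set (\bar R).
have mB : measurable B by exact: emeasurable_itv.
pose F (m : nat) (x : \bar R) : R :=
  Num.min 1 (m%:R * Num.max 0 (contract x - contract r%:E)).
have F01 m x : 0 <= F m x <= 1.
  rewrite /F le_min ler01/= ge_min lexx/= andbT mulr_ge0//.
  by rewrite le_max lexx.
have cF m : continuous (F m).
  move=> x; apply: (@continuous_min R (\bar R) (fun=> 1) _ x); first exact: cvg_cst.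
  apply: cvgM; first exact: cvg_cst.
  apply: (@continuous_max R (\bar R) (fun=> 0) _ x); first exact: cvg_cst.
  by apply: cvgB; [exact: continuous_contract|exact: cvg_cst].
have FB x : F m x @[m --> \oo] --> (\1_B x : R).
  have [rx|xr] := ltP r%:E x.
    rewrite indicE mem_set ?/B/= ?in_itv/= ?rx//.
    have c0 : 0 < contract x - contract r%:E by rewrite subr_gt0 lt_contract.
    apply: cvg_near_cst; exists (Num.truncn (contract x - contract r%:E)^-1).+1 => //.
    move=> m /= Hm; rewrite /F max_r ?ltW// min_l//.
    rewrite -ler_pdivrMr// mul1r (le_trans (ltW (truncnS_gt _)))//.
    by rewrite ler_nat.
  rewrite indicE memNset ?/B/= ?in_itv/= ?andbT; last by apply/negP; rewrite -leNgt.
  apply: cvg_near_cst; apply: nearW => m.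
  by rewrite /F max_l ?mulr0 ?min_r// subr_le0 le_contract.
have key d (T : measurableType d) (P : probability T R) (X : T -> \bar R) :
    measurable_fun setT X -> 
    \int[P]_w F m (X w) @[m --> \oo] --> fine (P (X @^-1` B)).
  move=> mX.
  have mXB : measurable (X @^-1` B) by rewrite -[X in measurable X]setTI; exact: mX.
  rewrite -(mean_indic P mXB).
  apply: (@mean_cvg _ _ _ _ _ _ 1).
  - by move=> m; apply: measurableT_comp => //; exact: continuous_ereal_measurable.
  - exact: measurable_indic.
  - by move=> m w; have /andP[? ?] := F01 m (X w); rewrite ger0_norm.
  - by apply: aeW => w; exact: FB.
have k1 := key _ _ P1 _ mX1; have k2 := key _ _ P2 _ mX2.
have fE : fine (P1 (X1 @^-1` B)) = fine (P2 (X2 @^-1` B)).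
  rewrite -(cvg_lim _ k1)// -(cvg_lim _ k2)//; congr (limn _).
  by apply/funext => m; exact: H.
have f1 : P1 (X1 @^-1` B) \is a fin_num.
  by rewrite fin_num_measure// -[X in measurable X]setTI; exact: (mX1 measurableT _ mB).
have f2 : P2 (X2 @^-1` B) \is a fin_num.
  by rewrite fin_num_measure// -[X in measurable X]setTI; exact: (mX2 measurableT _ mB).
by rewrite /= /distribution /pushforward/= -(fineK f1) -(fineK f2) fE.
Qed.

(** * Counts as series of naturals *)

Section epow_theory.
Context {R : realType}.
Implicit Types (z : R) (x y : \bar R).

Lemma epow_ge0E z x : (0 <= x)%E -> epow z x = if x is r%:E then z `^ r else 0.
Proof. by case: x => [r| |]//; rewrite lee_fin => r0; rewrite /epow/= max_l. Qed.

Lemma epowD z x y : 0 < z -> (0 <= x)%E -> (0 <= y)%E ->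
  epow z (x + y)%E = epow z x * epow z y.
Proof.
move=> z0 x0 y0; rewrite !epow_ge0E ?adde_ge0//.
case: x y x0 y0 => [r| |] [s| |]//= _ _; rewrite ?mul0r ?mulr0//.
by rewrite powRD// (gt_eqF z0) implybT.
Qed.

Lemma epow_sum z (I : Type) (s : seq I) (F : I -> \bar R) : 0 < z ->
  (forall i, (0 <= F i)%E) ->
  epow z (\sum_(i <- s) F i)%E = \prod_(i <- s) epow z (F i).
Proof.
move=> z0 F0; elim: s => [|i s IH].
  by rewrite !big_nil (epow_nat 0)// ltW.
by rewrite !big_cons epowD ?IH// sume_ge0.
Qed.

Lemma epow_scale z x k : 0 < z -> (0 < k)%N -> (0 <= x)%E ->
  epow z (k%:R%:E * x)%E = epow (z ^+ k) x.
Proof.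
move=> z0 k0 x0; have k0' : (0 < k%:R%:E :> \bar R)%E by rewrite lte_fin ltr0n.
rewrite !epow_ge0E ?mule_ge0 ?(ltW k0')//; case: x x0 => [r| |]// r0 /=.
  by rewrite -powR_mulrn ?(ltW z0)// powRrM.
by rewrite gt0_muley.
Qed.

(** At z = 1 continuity fails at infinity only, where z^oo = 0 by convention. *)
Lemma epow_continuous z x : 0 < z <= 1 -> z < 1 \/ x != +oo%E ->
  {for x, continuous (epow z)}.
Proof.
move=> /andP[z0 z1] zx.
have cpow (r : R) : {for r, continuous (fun s : R => z `^ (Num.max s 0))}.
  have -> : (fun s : R => z `^ (Num.max s 0)) = (fun s => expR (Num.max s 0 * ln z)).
    by apply/funext => s; rewrite /powR gt_eqF.
  apply: (continuous_comp _ (@continuous_expR R _)).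
  apply: cvgM; last exact: cvg_cst.
  by apply: (@continuous_max R R id (fun=> 0) r); [exact: cvg_id|exact: cvg_cst].
case: x zx => [r| |] zx.
- have idr : (y : \bar R) @[y --> r%:E] --> r%:E by exact: cvg_id.
  have [fin_near fc] := (fine_cvgP _ _).1 idr.
  have h : z `^ (Num.max (fine y) 0) @[y --> r%:E] --> z `^ (Num.max r 0).
    exact: (cvg_comp _ _ fc (cpow r)).
  apply: cvg_trans h; apply: near_eq_cvg.
  by apply: filterS fin_near => -[].
- have z1' : z < 1 by case: zx.
  apply/(cvgrPdist_lt (FF := ereal_nbhs_filter (+oo%E : \bar R))) => e e0 /=.
  pose M := ln e / ln z.
  have lnz : ln z < 0 by rewrite ln_lt0// z0.
  have zM : z `^ M = e.
    by rewrite /powR gt_eqF// /M divfK ?lt_eqF// lnK.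
  exists (Num.max M 0); split; first exact: num_real.
  move=> [y| |]//= My; last by rewrite subr0 normr0.
  rewrite sub0r normrN ger0_norm ?powR_ge0//.
  move: My; rewrite lte_fin gt_max => /andP[My y0].
  rewrite max_l ?(ltW y0)// -zM /powR gt_eqF// ltr_expR.
  by rewrite ltr_nM2r.
- apply/(cvgrPdist_lt (FF := ereal_nbhs_filter (-oo%E : \bar R))) => e e0 /=.
  exists 0; split; first exact: num_real.
  move=> [y| |]//= My; last by rewrite subrr normr0.
  by rewrite maxxx max_r ?subrr ?normr0// ltW -?lte_fin.
Qed.

End epow_theory.

Section counting_series.
Context {R : realType}.
Local Open Scope ereal_scope.

Lemma counting_natinf (T : choiceType) (A : set T) : natinf (counting A : \bar R).
Proof.
by rewrite /counting; case: ifP => _; [right; eexists|left].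
Qed.

Lemma counting_esum (T : choiceType) (A : set T) :
  counting A = \esum_(i in A) 1 :> \bar R.
Proof.
rewrite /counting; case: ifPn => /asboolP finA.
  rewrite esum_fset// fsbig_finite//=.
  by rewrite card_fset_sum1// natr_sum -sumEFin.
apply/esym/eqyP => r r0.
have [B BA Br] := infinite_set_fset (Num.truncn r).+1 finA.
apply: esum_ge; exists [set` B] => //.
apply: (@le_trans _ _ (Num.truncn r).+1%:R%:E).
  by rewrite lee_fin ltW// truncnS_gt.
move: Br; rewrite -(@ler_nat R) -lee_fin => /le_trans; apply.
by rewrite fsbig_finite//= card_fset_sum1 sumEFin natr_sum// set_fsetK.
Qed.

Lemma counting_pair_series n (b : nat * 'I_n -> bool) :
  counting [set p | b p] =
  \sum_(k <oo) (\sum_(l < n) b (k, l))%N%:R%:E :> \bar R.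
Proof.
rewrite counting_esum esum_mkcond nneseries_esumT//.
rewrite [LHS](_ : _ = \esum_(p in setT `*`` (fun=> setT)) (b (p.1, p.2))%:R%:E); last first.
  have -> : setT `*`` (fun=> setT) = [set: nat * 'I_n] by apply/seteqP; split.
  apply: eq_esum => -[k l] _ /=; case: ifPn; first by rewrite inE/= => ->.
  by rewrite notin_setE/= => /negP/negbTE ->.
rewrite -(@esum_esum R _ _ setT (fun=> setT) (fun k l => (b (k, l))%:R%:E))//.
apply: eq_esum => k _.
have eT : [set: 'I_n] = [set` enum 'I_n].
  by apply/seteqP; split => // i _ /=; rewrite mem_enum.
rewrite esum_fset//; last exact: finite_finset.
by rewrite eT -fsbig_seq ?enum_uniq// natr_sum -sumEFin big_enum.
Qed.

Lemma counting_series (b : nat -> bool) :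
  counting [set k | b k] = \sum_(k <oo) (b k)%:R%:E :> \bar R.
Proof.
rewrite counting_esum esum_mkcond nneseries_esumT//; apply: eq_esum => k _.
case: ifPn; first by rewrite inE/= => ->.
by rewrite notin_setE/= => /negP/negbTE ->.
Qed.

End counting_series.

Lemma nat_series_cvg (R : realType) (c : nat -> nat) :
  ((\sum_(k < K) c k)%N%:R%:E : \bar R) @[K --> \oo] -->
  (\sum_(k <oo) (c k)%:R%:E)%E.
Proof.
have : cvgn (fun K => \sum_(0 <= k < K) ((c k)%:R%:E : \bar R))%E.
  by apply: is_cvg_nneseries.
apply: cvg_trans; apply: near_eq_cvg; apply: nearW => K.
by rewrite natr_sum -sumEFin big_mkord.
Qed.

(** The generating function of a possibly infinite count is the limit of those of
    its finite truncations, to which finite independence applies. *)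
Lemma epow_series (R : realType) (z : R) (c : nat -> nat) :
  0 < z <= 1 -> z < 1 \/ (\sum_(k <oo) (c k)%:R%:E)%E != +oo%E :> \bar R ->
  \prod_(k < K) z ^+ c k @[K --> \oo] --> epow z (\sum_(k <oo) (c k)%:R%:E)%E.
Proof.
move=> z01 zc.
have h := cvg_comp _ _ (@nat_series_cvg R c) (epow_continuous z01 zc).
apply: cvg_trans h; apply: near_eq_cvg; apply: nearW => K /=.
rewrite max_l// powR_mulrn ?expr_sum// ltW//; by case/andP: z01.
Qed.

Lemma measurable_counting_series d (T : measurableType d) (R : realType)
  (c : nat -> T -> nat) :
  (forall k, measurable_fun setT (fun w => (c k w)%:R : R)) ->
  measurable_fun setT (fun w => \sum_(k <oo) ((c k w)%:R%:E : \bar R))%E.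
Proof.
move=> mc; apply: ge0_emeasurable_sum => //.
by move=> k _; exact/measurable_EFinP.
Qed.

(** * The generating function of the Poisson law *)

Section poisson_generating_function.
Context d (T : measurableType d) (R : realType) (P : probability T R).
Variables (X : T -> \bar R).
Hypothesis mX : measurable_fun setT X.

Let mXA (A : set (\bar R)) : measurable A -> measurable (X @^-1` A).
Proof. by move=> mA; rewrite -[X in measurable X]setTI; exact: mX. Qed.

(** The formula also covers r = 0, which the definition of [poisson_prob] treats
    apart. *)
Lemma poisson_prob_set1 (r : R) k : 0 <= r ->
  poisson_prob r 0 [set k] = (expR (- r) * exp_coeff r k)%:E.
Proof.
move=> r0; rewrite /poisson_prob; case: ltP => [r0'|r0'].
  rewrite esum_set1/poisson_pmf ?r0' /exp_coeff; first by rewrite mulrC.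
  by rewrite lee_fin !mulr_ge0// ?exprn_ge0// expR_ge0.
have -> : r = 0 by apply/eqP; rewrite eq_le r0' r0.
rewrite oppr0 expR0 mul1r /exp_coeff diracE/= expr0n.
case: k => [|k].
  by rewrite mem_set//= fact0 divr1.
by rewrite memNset//= mul0r.
Qed.

Lemma Pois_ae_nat (r : R) : 0 <= r -> has_law P X (Pois r%:E) ->
  \forall w \ae P, exists k : nat, X w = k%:R%:E.
Proof.
move=> r0 lX; pose N := \bigcup_k [set (k%:R%:E : \bar R)].
have mN : measurable N by exact: bigcup_measurable.
exists (~` (X @^-1` N)); split.
- by apply: measurableC; exact: mXA.
- rewrite probability_setC; last exact: mXA.
  rewrite lX//= (_ : [set k : nat | N k%:R%:E] = setT); last first.
    by apply/seteqP; split => // k _; exists k.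
  by rewrite (@probability_setT _ _ _ (poisson_prob r 0)) subee.
- by move=> w /= nw [k _ /=] Xk; apply: nw; exists k.
Qed.

Lemma Pois_ae_natinf (a : \bar R) : (0 <= a)%E -> has_law P X (Pois a) ->
  \forall w \ae P, natinf (X w).
Proof.
case: a => [r| |]//.
  by rewrite lee_fin => r0 /(Pois_ae_nat r0); apply: filterS => w; right.
move=> _ lX; exists (~` (X @^-1` [set +oo%E])); split.
- by apply: measurableC; exact: mXA.
- rewrite probability_setC; last exact: mXA.
  by rewrite lX// [Pois _ _]diracE mem_set// subee.
- by move=> w /= nw Xk; apply: nw; left.
Qed.

(** Written with [epow (expR (-1))], which on [0, oo] is x |-> exp (- x) with
    value 0 at infinity, the formula covers finite and infinite means at once. *)
Lemma Pois_pgf (a : \bar R) z : (0 <= a)%E -> 0 < z <= 1 ->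
  z < 1 \/ a != +oo%E -> has_law P X (Pois a) ->
  \int[P]_w epow z (X w) = epow (expR (-1)) (a * (1 - z)%:E)%E.
Proof.
move=> a0 z01 za lX; have [z0 z1] := andP z01.
have mEX : measurable_fun setT (fun w => epow z (X w)).
  by apply: measurableT_comp mX; apply: (bounded_mfun_epow _).1; rewrite ltW.
case: a a0 za lX => [r| |]// r0 za lX; last first.
  have z1' : z < 1 by case: za.
  rewrite gt0_mulye; last by rewrite lte_fin subr_gt0.
  rewrite (@mean_ae_eq _ _ _ _ _ (fun=> 0)) ?mean_cst//.
  exists (~` (X @^-1` [set +oo%E])); split.
  - by apply: measurableC; exact: mXA.
  - rewrite probability_setC; last exact: mXA.
    by rewrite lX// [Pois _ _]diracE mem_set// subee.
  - by move=> w /= nw Xk; apply: nw; rewrite Xk.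
rewrite lee_fin in r0.
rewrite -EFinM epow_ge0E; last by rewrite lee_fin mulr_ge0// subr_ge0.
rewrite /powR gt_eqF ?expR_gt0// expRK.
have -> : r * (1 - z) * -1 = - r + r * z by ring.
rewrite expRD.
(* the partial sums of the generating series, as functions on [T] *)
pose F K w := \sum_(k < K) z ^+ k * \1_(X @^-1` [set k%:R%:E]) w : R.
have mk k : measurable (X @^-1` [set k%:R%:E]) by exact: mXA.
have bF K : bounded_mfun (F K).
  apply: bounded_mfun_sum => k; apply: (bounded_mfunM (bounded_mfun_cst _ _)).
  exact: bounded_mfun_indic.
have FX w j K : X w = j%:R%:E -> F K w = if (j < K)%N then z ^+ j else 0.
  move=> Xw; have Fk (k : nat) : \1_(X @^-1` [set k%:R%:E]) w = (k == j)%:R :> R.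
    rewrite indicE; congr ((nat_of_bool _)%:R); apply/idP/eqP => [|->].
      by rewrite inE/= Xw => -[] /eqP; rewrite eqr_nat => /eqP.
    by rewrite inE.
  rewrite /F; under eq_bigr do rewrite Fk.
  case: ifPn => jK.
    rewrite (bigD1 (Ordinal jK))//= eqxx mulr1 big1 ?addr0// => i /negP ij.
    case: eqP => ije; last by rewrite mulr0.
    by exfalso; apply: ij; apply/eqP/val_inj.
  rewrite big1// => i _; case: eqP => ije; last by rewrite mulr0.
  by move: jK; rewrite -ije ltn_ord.
have EF K : \int[P]_w F K w = expR (- r) * series (exp_coeff (r * z)) K.
  rewrite /F mean_sum; last first.
    by move=> k; apply: (bounded_mfunM (bounded_mfun_cst _ _)); exact: bounded_mfun_indic.
  rewrite /series/= big_distrr/= big_mkord; apply: eq_bigr => k _.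
  rewrite meanZ; last exact: bounded_mfun_indic.
  rewrite mean_indic// lX//=.
  rewrite (_ : [set k0 : nat | _] = [set (k : nat)]); last first.
    apply/seteqP; split => j /=; last by move=> ->.
    by move=> [] /eqP; rewrite eqr_nat => /eqP.
  by rewrite poisson_prob_set1//= /exp_coeff/= exprMn; ring.
have aeN := Pois_ae_nat r0 lX.
have c1 : \int[P]_w F K w @[K --> \oo] --> \int[P]_w epow z (X w).
  have F01 K w : `|F K w| <= 1.
    have [[j Xw]|nX] := pselect (exists j : nat, X w = j%:R%:E).
      rewrite (FX _ _ _ Xw); case: ifP => _; last by rewrite normr0.
      by rewrite ger0_norm ?exprn_ge0 ?(ltW z0)// exprn_ile1// ltW.
    rewrite /F big1 ?normr0// => k _; rewrite indicE memNset ?mulr0//= => Xk.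
    by apply: nX; exists k.
  apply: (@mean_cvg _ _ _ _ _ _ 1) => //; first by move=> K; exact: (bF K).1.
  apply: filterS aeN => w [j Xw].
  rewrite Xw epow_nat ?(ltW z0)//.
  apply: cvg_near_cst; exists j.+1 => // K /= jK.
  by rewrite (FX _ _ _ Xw) jK.
have c2 : \int[P]_w F K w @[K --> \oo] --> expR (- r) * expR (r * z).
  under eq_fun do rewrite EF.
  have h : series (exp_coeff (r * z)) K @[K --> \oo] --> expR (r * z).
    exact: (is_cvg_series_exp_coeff (r * z)).
  by apply: cvgM h; exact: cvg_cst.
by rewrite -(cvg_lim _ c1)// -(cvg_lim _ c2).
Qed.

End poisson_generating_function.

(** * Customers of one batch and order statistics *)

Lemma sorted_nth_le_count (R : realDomainType) (s : seq R) (u : R) i :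
  sorted <=%R s -> (i < size s)%N ->
  (s`_i <= u) = (i < count (fun y => (y <= u)%R) s)%N.
Proof.
elim: s i => [//|y s IH] i sys; have ss := path_sorted sys.
have ys := order_path_min le_trans sys.
have [yu|uy] := leP y u.
  by case: i => [|i] si /=; rewrite ?yu// add1n ltnS IH.
have c0 : count (fun y => (y <= u)%R) s = 0%N.
  apply/eqP; rewrite -leqn0 leqNgt -has_count; apply/hasPn => t ts.
  by rewrite -ltNge (lt_le_trans uy)// (allP ys).
rewrite /= [y <= u]leNgt uy c0 /=; case: i => [|i] /= si; first by rewrite leNgt uy.
by apply/negbTE; rewrite -ltNge (lt_le_trans uy)// (allP ys)// mem_nth.
Qed.

Section thinning.
Context {R : realType}.
Implicit Types (z u x : R).

(** The factor contributed to z^Q by a customer of age [u] and service [x]. *)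
Definition presence z u x : R := if u < x then z else 1.

Lemma presenceE z u x : presence z u x = 1 - (1 - z) * \1_(`]u, +oo[) x.
Proof.
rewrite /presence indicE; case: ltP => ux.
  by rewrite mem_set/= ?in_itv/= ?ux//; ring.
by rewrite memNset/= ?mulr0 ?subr0// in_itv/= andbT; apply/negP; rewrite -leNgt.
Qed.

Lemma bounded_mfun_presence z u : bounded_mfun (presence z u).
Proof.
rewrite (_ : presence z u = fun x => 1 + - ((1 - z) * \1_(`]u, +oo[) x)).
  apply: bounded_mfunD (bounded_mfun_cst _ _) (bounded_mfunN _).
  by apply: bounded_mfunM (bounded_mfun_cst _ _) (bounded_mfun_indic _ _); exact: measurable_itv.
by apply/funext => x; exact: presenceE.
Qed.

Lemma presence_ge0 z u x : 0 <= z -> 0 <= presence z u x.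
Proof. by rewrite /presence; case: ifP. Qed.

Lemma presence_le1 z u x : z <= 1 -> presence z u x <= 1.
Proof. by rewrite /presence; case: ifP. Qed.

Definition customer_pgf (G : probability R R) z u : R :=
  1 - (1 - z) * fine (G `]u, +oo[%classic).

Lemma mean_presence d (T : measurableType d) (P : probability T R)
  (G : probability R R) (X : T -> R) z u :
  measurable_fun setT X -> has_law P X G ->
  \int[P]_w presence z u (X w) = customer_pgf G z u.
Proof.
move=> mX lX; rewrite /customer_pgf.
have mI : measurable (X @^-1` `]u, +oo[%classic).
  by rewrite -[X in measurable X]setTI; apply: mX => //; exact: measurable_itv.
under eq_Rintegral do rewrite presenceE.
have bI : bounded_mfun (fun w => \1_(`]u, +oo[) (X w) : R).
  by apply: (bounded_mfun_comp mX); apply: bounded_mfun_indic; exact: measurable_itv.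
rewrite meanB; [|exact: bounded_mfun_cst|by apply: bounded_mfunM bI; exact: bounded_mfun_cst].
rewrite meanZ// mean_cst; congr (_ - _ * _).
rewrite -lX; last exact: measurable_itv.
by rewrite -(mean_indic P mI).
Qed.

Lemma customer_pgf_nd (G : probability R R) z u v : z <= 1 -> u <= v ->
  customer_pgf G z u <= customer_pgf G z v.
Proof.
move=> z1 uv; rewrite lerB// ler_wpM2l ?subr_ge0// fine_le ?fin_num_measure//.
apply: le_measure; rewrite ?inE//.
by move=> x /=; rewrite !in_itv/= !andbT; exact: le_lt_trans.
Qed.

Lemma customer_pgf_bnd (G : probability R R) z u : 0 <= z <= 1 ->
  z <= customer_pgf G z u <= 1.
Proof.
move=> /andP[z0 z1]; rewrite /customer_pgf.
have p0 : 0 <= fine (G `]u, +oo[%classic) by rewrite fine_ge0.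
have p1 : fine (G `]u, +oo[%classic) <= 1.
  by rewrite -lee_fin fineK ?fin_num_measure// probability_le1.
by apply/andP; split; nra.
Qed.

(** 1 - E[z^N], where N is the number of customers present in a batch of age [u];
    the logarithm of the generating function of the number in system is - lambda
    times its integral over the ages. *)
Definition batch_loss (G : probability R R) z n u : R :=
  1 - customer_pgf G z u ^+ n.

Lemma batch_loss_ni G z n : 0 <= z <= 1 ->
  {homo batch_loss G z n : u v / u <= v >-> v <= u}.
Proof.
move=> z01 u v uv; have /andP[z0 z1] := z01.
have /andP[a _] := customer_pgf_bnd G u z01.
rewrite /batch_loss lerB// lerXn2r ?nnegrE ?customer_pgf_nd// ?(le_trans z0)//.
by have /andP[] := customer_pgf_bnd G v z01.
Qed.

Lemma batch_loss_bnd G z n u : 0 <= z <= 1 -> 0 <= batch_loss G z n u <= 1.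
Proof.
move=> z01; have /andP[z0 z1] := z01.
have /andP[a b] := customer_pgf_bnd G u z01.
rewrite /batch_loss subr_ge0 exprn_ile1 ?(le_trans z0)//=.
by rewrite lerBlDr lerDl exprn_ge0// (le_trans z0).
Qed.

Lemma measurable_batch_loss G z n : 0 <= z <= 1 ->
  measurable_fun setT (batch_loss G z n).
Proof.
move=> z01; apply: nonincreasing_measurable => //.
by move=> u v uv; exact: batch_loss_ni.
Qed.

End thinning.

Section order_statistics.
Context {R : realType}.
Implicit Types (z u : R).

Lemma size_order_sample n (T : Type) (X : 'I_n -> T -> R) w :
  size (sort <=%R [seq X k w | k : 'I_n]) = n.
Proof. by rewrite size_sort size_map size_enum_ord. Qed.

(** This is how order statistics enter: only through the counts of sample
    variables below a level. *)
Lemma order_stat_le n (T : Type) (X : 'I_n -> T -> R) i w u : (i < n)%N ->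
  (order_stat X i.+1 w <= u) = (i < \sum_(k < n) (X k w <= u)%R)%N.
Proof.
move=> ni; rewrite /order_stat sorted_nth_le_count ?size_order_sample//; last first.
  by apply: sort_sorted; exact: le_total.
rewrite (permP (permEl (perm_sort _ _))) count_map -sum1_count big_mkcond/=.
by rewrite big_enum/=; congr (_ < _)%N; apply: eq_bigr => k _; case: leP.
Qed.

Lemma measurable_order_stat n d (T : measurableType d) (X : 'I_n -> T -> R) j :
  (j <= n)%N -> (forall k, measurable_fun setT (X k)) ->
  measurable_fun setT (order_stat X j).
Proof.
case: j => [|i] ni mX; first exact: measurable_cst.
apply: (measurability _ (RGenOInfty.measurableE R)) => _ [_ [u ->] <-].
rewrite setTI.
have mXu k : measurable_fun setT (fun w => (X k w <= u)%R : bool).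
  by apply: measurable_fun_ler => //; exact: measurable_cst.
have -> : order_stat X i.+1 @^-1` `]u, +oo[ =
    [set w | \sum_(k < n) (if (X k w <= u)%R then 1 else 0 : R) <= i%:R].
  have e w : \sum_(k < n) (if (X k w <= u)%R then 1 else 0 : R) =
      (\sum_(k < n) (X k w <= u)%R)%:R.
    by rewrite natr_sum; apply: eq_bigr => k _; case: ifP.
  apply/seteqP; split => w /=;
    by rewrite in_itv/= andbT ltNge order_stat_le// -leqNgt e ler_nat.
rewrite -[X in measurable X]setTI; apply: measurable_fun_le => //.
by apply: measurable_sum => k; exact: measurable_fun_ifT.
Qed.

(** At most one gap contains [u], and its index is the number of sample variables
    that are at most [u]. *)
Lemma presence_gap_sum n (T : Type) (X : 'I_n -> T -> R) w z u : 0 <= u ->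
  1 - \prod_(k < n) presence z u (X k w) =
  \sum_(j < n) (1 - z ^+ (n - j)) *
     \1_(`[order_stat X j w, order_stat X j.+1 w[) u.
Proof.
move=> u0; set c := (\sum_(k < n) (X k w <= u)%R)%N.
have cn : (c <= n)%N.
  rewrite -[leqRHS]card_ord -sum1_card /c; apply: leq_sum => k _.
  by case: leP.
(* if c = n then [u] lies beyond all the gaps and both sides vanish *)
have prodE : \prod_(k < n) presence z u (X k w) = z ^+ (n - c).
  have -> : (n - c)%N = (\sum_(k < n) (u < X k w)%R)%N.
    rewrite -[X in (X - _)%N]card_ord -sum1_card /c.
    rewrite (eq_bigr (fun k : 'I_n => (X k w <= u)%R + (u < X k w)%R)%N); last first.
      by move=> k _; case: leP.
    by rewrite big_split/= addKn.
  rewrite expr_sum; apply: eq_bigr => k _; rewrite /presence.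
  by case: ifP; rewrite ?expr1 ?expr0.
have indE (j : 'I_n) :
    \1_(`[order_stat X j w, order_stat X j.+1 w[) u = (j == c :> nat)%:R :> R.
  rewrite indicE mem_setE in_itv/=; congr ((nat_of_bool _)%:R).
  rewrite [u < _]ltNge order_stat_le// -leqNgt -/c eqn_leq andbC.
  by case: j => -[|j] /= jn; rewrite ?u0 ?order_stat_le ?(ltnW jn)// andbC.
rewrite prodE; under eq_bigr do rewrite indE.
move: cn; rewrite leq_eqVlt => /orP[/eqP cE|cn].
  rewrite cE subnn expr0 subrr big1// => j _.
  by rewrite ltn_eqF ?mulr0.
rewrite (bigD1 (Ordinal cn))//= eqxx mulr1 big1 ?addr0// => j jc.
by rewrite (_ : _ == _ = false) ?mulr0//; apply/negbTE.
Qed.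

Lemma order_stat_nd n (T : Type) (X : 'I_n -> T -> R) w (j : nat) : (j < n)%N ->
  (forall k, 0 <= X k w) -> order_stat X j w <= order_stat X j.+1 w.
Proof.
move=> jn X0; case: j jn => [|i] jn /=.
  set s := sort _ _; have : s`_0 \in s by rewrite mem_nth// size_order_sample.
  by rewrite mem_sort => /mapP[k _ ->].
apply: (sorted_leq_nth le_trans) => //; rewrite ?inE ?size_order_sample ?(ltnW jn)//.
by apply: sort_sorted; exact: le_total.
Qed.

Local Open Scope ereal_scope.

Lemma integral_presence_gaps n (T : Type) (X : 'I_n -> T -> R) w z :
  (0 <= z <= 1)%R -> (forall k, 0 <= X k w)%R ->
  \int[@lebesgue_measure R]_(u in `[0%R, +oo[)
     (1 - \prod_(k < n) presence z u (X k w))%R%:E =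
  \sum_(j < n) (1 - z ^+ (n - j))%:E *
     (order_stat X j.+1 w - order_stat X j w)%:E.
Proof.
move=> /andP[z0 z1] X0.
have S0 j : (j <= n)%N -> (0 <= order_stat X j w)%R.
  by elim: j => // j IH jn; rewrite (le_trans (IH (ltnW jn)))// order_stat_nd.
transitivity (\int[@lebesgue_measure R]_(u in `[0%R, +oo[)
    \sum_(j < n) (1 - z ^+ (n - j))%:E *
     (\1_(`[order_stat X j w, order_stat X j.+1 w[) u)%:E).
  apply: eq_integral => u; rewrite inE/= in_itv/= andbT => u0.
  by rewrite presence_gap_sum// -sumEFin; apply: eq_bigr => j _; rewrite EFinM.
have c0 (j : 'I_n) : 0 <= (1 - z ^+ (n - j))%:E.
  by rewrite lee_fin subr_ge0 exprn_ile1.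
rewrite ge0_integral_sum//.
- apply: eq_bigr => j _; rewrite ge0_integralZl//.
  rewrite integral_indic//= setIidl.
    rewrite lebesgue_measure_itv/= lte_fin.
    have := order_stat_nd (ltn_ord j) X0.
    by rewrite le_eqVlt => /orP[/eqP ->|->]; rewrite ?ltxx ?subrr ?EFinB.
    move=> u /=; rewrite !in_itv/= andbT => /andP[Su _].
    by rewrite (le_trans _ Su)// S0// ltnW.
  by apply/measurable_EFinP; exact: measurable_indic.
- move=> j; apply: emeasurable_funM; first exact: measurable_cst.
  by apply/measurable_EFinP; exact: measurable_indic.
- by move=> j u _; rewrite mule_ge0.
Qed.

End order_statistics.

Section mean_gaps.
Context d (T : measurableType d) (R : realType) (P : probability T R) (n : nat).
Variables (G : probability R R) (X : 'I_n -> {RV P >-> R}).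
Hypotheses (iX : iid P (fun i => X i : T -> R) G) (G0 : G [set x | 0 <= x] = 1%E).

Let mX k : measurable_fun setT (X k).
Proof. exact: measurable_funP. Qed.

Lemma iid_ae_ge0 : \forall w \ae P, forall k, 0 <= X k w.
Proof.
apply: filter_forall => k.
have mpos : measurable [set x : R | 0 <= x].
  rewrite (_ : [set x | _] = `[0, +oo[%classic) //.
  by apply/seteqP; split => x /=; rewrite in_itv/= andbT.
exists (~` (X k @^-1` [set x | 0 <= x])); split.
- by apply: measurableC; exact: measurable_funPTI.
- rewrite probability_setC; last exact: measurable_funPTI.
  by rewrite iX.2// G0 subee.
- by move=> w /= nw X0; exact: nw.
Qed.

Lemma mean_prod_presence z u : 0 <= z <= 1 ->
  \int[P]_w (\prod_(k < n) presence z u (X k w)) = customer_pgf G z u ^+ n.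
Proof.
move=> /andP[z0 z1].
have := @mean_prod_indep _ _ _ _ _ P _ (fun k => X k : T -> R) setT mX measurableT _
  (index_enum 'I_n) (fun=> presence z u) (index_enum_uniq _)
  (fun=> bounded_mfun_presence z u) (fun k x => presence_ge0 u x z0).
rewrite probability_setT mul1r => H.
rewrite -[n in RHS]card_ord -prodr_const.
rewrite (eq_bigr (fun k => \int[P]_w presence z u (X k w))); last first.
  by move=> k _; rewrite (mean_presence (G := G))//; exact: iX.2.
rewrite -H; first by apply: eq_Rintegral => w _; rewrite indicT mul1r.
by move=> J A uJ mA; rewrite setTI mul1e iX.1.
Qed.

(** Tonelli's theorem for 1 - z^N(u): integrating over the sample first gives
    [batch_loss], integrating over [u] first gives the gaps.  Both sides may be
    infinite. *)
Lemma integral_batch_loss z : 0 <= z <= 1 ->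
  (\int[@lebesgue_measure R]_(u in `[0%R, +oo[) (batch_loss G z n u)%:E =
   \sum_(j < n) (1 - z ^+ (n - j))%:E *
     'E_P[(fun w => order_stat X j.+1 w - order_stat X j w)%R])%E.
Proof.
move=> z01; have [z0 z1] := andP z01.
pose f (p : T * R) : \bar R :=
  ((1 - \prod_(k < n) presence z p.2 (X k p.1)) * \1_(`[0, +oo[) p.2)%:E.
have pr01 w u : 0 <= \prod_(k < n) presence z u (X k w) <= 1.
  rewrite prodr_ge0 => [|k _]; last exact: presence_ge0.
  by apply: prodr_ile1 => k _; rewrite presence_ge0// presence_le1.
have f0 p : (0 <= f p)%E.
  by rewrite lee_fin mulr_ge0// subr_ge0; case/andP: (pr01 p.1 p.2).
have mf : measurable_fun setT f.
  apply/measurable_EFinP; apply: measurable_funM.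
    apply: measurable_funB => //; apply: measurable_prod => k _.
    apply: measurable_fun_ifT => //.
    apply: measurable_fun_ltr; first exact: measurable_snd.
    exact: measurableT_comp (mX k) measurable_fst.
  apply: (@measurableT_comp _ _ _ _ _ _ (\1_(`[0, +oo[%classic) : R -> R)) => //.
have tonelli := @fubini_tonelli _ _ _ _ R P (@lebesgue_measure R) f mf f0.
transitivity (\int[@lebesgue_measure R]_u \int[P]_w f (w, u))%E.
  rewrite integral_mkcond; apply: eq_integral => u _; rewrite patchE.
  case: ifPn => u0.
    transitivity (\int[P]_w (1 - \prod_(k < n) presence z u (X k w)))%:E.
      rewrite meanB ?mean_cst ?mean_prod_presence//; first exact: bounded_mfun_cst.
      apply: bounded_mfun_prod => k.
      exact: (bounded_mfun_comp (mX k) (bounded_mfun_presence z u)).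
    rewrite /Rintegral fineK.
      by apply: eq_integral => w _; rewrite /f/= indicE u0 mulr1.
    apply: integrable_fin_num => //; apply: bounded_mfun_integrable.
    apply: bounded_mfunD (bounded_mfun_cst _ _) (bounded_mfunN _).
    by apply: bounded_mfun_prod => k; exact: (bounded_mfun_comp (mX k) (bounded_mfun_presence z u)).
  by rewrite integral0_eq// => w _; rewrite /f/= indicE (negbTE u0) mulr0.
rewrite -tonelli.
have mgap (j : 'I_n) : measurable_fun setT
    (fun w => order_stat X j.+1 w - order_stat X j w : R).
  by apply: measurable_funB; apply: measurable_order_stat => //; rewrite ?(ltnW (ltn_ord j)).
(* the gaps are nonnegative only almost surely; their positive parts agree
   with them there and can be integrated without integrability conditions *)
pose g j w := (Num.max 0 (order_stat X j.+1 w - order_stat X j w))%:E : \bar R.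
have mg (j : 'I_n) : measurable_fun setT (g j).
  by apply/measurable_EFinP; apply: measurable_maxr => //; exact: mgap.
have g0 j w : (0 <= g j w)%E by rewrite lee_fin le_max lexx.
have c0 (j : 'I_n) : (0 <= (1 - z ^+ (n - j))%:E)%E.
  by rewrite lee_fin subr_ge0 exprn_ile1.
have gE w : (forall k, 0 <= X k w) -> forall j : 'I_n,
    g j w = (order_stat X j.+1 w - order_stat X j w)%:E.
  by move=> X0 j; rewrite /g max_r// subr_ge0 order_stat_nd.
transitivity (\int[P]_w \sum_(j < n) (1 - z ^+ (n - j))%:E * g j w)%E.
  apply: ge0_ae_eq_integral => //.
  - exact: measurable_fun_fubini_tonelli_F.
  - apply: emeasurable_sum => j; apply: emeasurable_funM => //.
  - by move=> w _; exact: integral_ge0.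
  - by move=> w _; apply: sume_ge0 => j _; exact: mule_ge0.
  - apply: filterS iid_ae_ge0 => w X0 _.
    under eq_bigr do rewrite gE//.
    rewrite -(integral_presence_gaps z01 X0) [RHS]integral_mkcond.
    apply: eq_integral => u _; rewrite /f/= patchE indicE.
    by case: ifP; rewrite ?mulr1 ?mulr0.
rewrite ge0_integral_sum//; last 2 first.
- by move=> j; apply: emeasurable_funM.
- by move=> j w _; exact: mule_ge0.
apply: eq_bigr => j _; rewrite ge0_integralZl//; congr (_ * _)%E.
rewrite unlock; apply: ae_eq_integral => //.
  by apply/measurable_EFinP; exact: mgap.
by apply: filterS iid_ae_ge0 => w X0 _; exact: gE.
Qed.

Lemma expectation_gap_ge0 (j : 'I_n) :
  (0 <= 'E_P[(fun w => order_stat X j.+1 w - order_stat X j w)%R])%E.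
Proof.
have mgap : measurable_fun setT
    (fun w => order_stat X j.+1 w - order_stat X j w : R).
  by apply: measurable_funB; apply: measurable_order_stat => //; rewrite ?(ltnW (ltn_ord j)).
rewrite unlock.
rewrite (_ : (\int[P]_w _ = \int[P]_w (Num.max 0 (order_stat X j.+1 w - order_stat X j w))%:E)%E).
  by apply: integral_ge0 => w _; rewrite lee_fin le_max lexx.
apply: ae_eq_integral => //.
- exact/measurable_EFinP.
- by apply/measurable_EFinP; exact: measurable_maxr.
- by apply: filterS iid_ae_ge0 => w X0 _; rewrite max_r// subr_ge0 order_stat_nd.
Qed.

End mean_gaps.

(** * Reindexing and events of a process *)

Section reindexing.
Context d1 d2 (T : measurableType d1) (U : measurableType d2) (R : realType).
Variables (P : probability T R) (I I' : eqType) (X : I -> T -> U) (E : set T).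
Variable (h : I' -> I).
Hypothesis injh : injective h.
Hypothesis indepE : forall (J : seq I) (A : I -> set U),
  uniq J -> (forall i, measurable (A i)) ->
  P (E `&` \bigcap_(i in [set` J]) (X i @^-1` A i)) =
  (P E * \prod_(i <- J) P (X i @^-1` A i))%E.

(** Sets attached to the new indices are carried to the old ones along [h],
    with the whole space attached to an index outside the image. *)
Lemma product_rule_reindex (J : seq I') (A : I' -> set U) :
  uniq J -> (forall i, measurable (A i)) ->
  P (E `&` \bigcap_(i in [set` J]) (X (h i) @^-1` A i)) =
  (P E * \prod_(i <- J) P (X (h i) @^-1` A i))%E.
Proof.
move=> uJ mA.
pose A' p := if pselect (exists q, h q = p) is left e then A (projT1 (cid e)) else setT.
have A'h q : A' (h q) = A q.
  rewrite /A'; case: pselect => [e|[]]; last by exists q.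
  by case: (cid e) => /= q' /injh ->.
have mA' p : measurable (A' p) by rewrite /A'; case: pselect.
have := indepE (J := map h J) (A := A') _ mA'.
rewrite map_inj_uniq// => /(_ uJ).
rewrite big_map (eq_bigr (fun i => P (X (h i) @^-1` A i))); last by move=> i _; rewrite A'h.
move=> <-; congr (P (_ `&` _)); apply/seteqP; split => w wJ i /=.
  by move=> /mapP[q qJ ->]; rewrite A'h; exact: wJ.
by move=> iJ; have := wJ (h i) (map_f h iJ); rewrite /= A'h.
Qed.

End reindexing.

Section process_events.
Context d (U : measurableType d) (T : pointedType) (I : choiceType) (X : I -> T -> U).

Lemma process_sigma_preimage i (A : set U) : measurable A ->
  process_sigma X (X i @^-1` A).
Proof.
move=> mA; apply: sub_sigma_algebra; exists i => //.
by exists A => //; rewrite setTI.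
Qed.

Lemma process_sigma_bigcap (J : choiceType) (D : set J) (F : J -> set T) :
  finite_set D -> (forall i, D i -> process_sigma X (F i)) ->
  process_sigma X (\bigcap_(i in D) F i).
Proof.
move=> fD DF.
exact: (@fin_bigcap_measurable _ (g_sigma_algebraType
  (\bigcup_i preimage_set_system setT (X i) measurable)) J D F fD DF).
Qed.

End process_events.

(** * Batches arriving in slots *)

Section batches.
Context d (T : measurableType d) (R : realType) (P : probability T R).
Variables (lambda : R) (n : nat) (G : probability R R).
Variables (tau : nat -> {RV P >-> R}) (S : nat * 'I_n -> {RV P >-> R}).
Hypothesis hq : batch_queue lambda G tau S.
Variable z : R.
Hypothesis z01 : 0 <= z <= 1.

Section slots.
Variables (O : finType) (B : O -> set R) (c : O -> option R) (K : nat).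
Hypothesis mB : forall o, measurable (B o).

(** An age [None] stands for a batch without influence on the count, because it
    arrives outside of the observation window. *)
Definition age_presence (a : option R) (x : R) : R :=
  if a is Some u then presence z u x else 1.

Definition age_pgf (a : option R) : R :=
  if a is Some u then customer_pgf G z u ^+ n else 1.

Lemma bounded_mfun_age_presence a : bounded_mfun (age_presence a).
Proof. by case: a => [u|]; [exact: bounded_mfun_presence|exact: bounded_mfun_cst]. Qed.

Lemma age_presence_ge0 a x : 0 <= age_presence a x.
Proof. by case: a => [u|] //=; apply: presence_ge0; case/andP: z01. Qed.

Let mtau k : measurable_fun setT (tau k). Proof. exact: measurable_funP. Qed.
Let mS p : measurable_fun setT (S p). Proof. exact: measurable_funP. Qed.

(** Averaging over the services.  The product over batches of a sum over slots is
    expanded into a sum over assignments of the batches to slots; each term is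
    an event of the arrival process times a product of functions of distinct
    services, hence factorizes. *)
Lemma mean_slots :
  \int[P]_w (\prod_(k < K) \sum_(o : O) \1_(B o) (tau k w) *
      \prod_(l < n) age_presence (c o) (S (nat_of_ord k, l) w)) =
  \int[P]_w (\prod_(k < K) \sum_(o : O) \1_(B o) (tau k w) * age_pgf (c o)).
Proof.
have bB k o : bounded_mfun (fun w => \1_(B o) (tau k w) : R).
  by apply: (bounded_mfun_comp (mtau k)); exact: bounded_mfun_indic.
have bV p o : bounded_mfun (fun w => age_presence (c o) (S p w)).
  exact: (bounded_mfun_comp (mS p) (bounded_mfun_age_presence _)).
under eq_Rintegral do rewrite bigA_distr_bigA/=.
under [RHS]eq_Rintegral do rewrite bigA_distr_bigA/=.
rewrite mean_sum; last first.
  by move=> f; apply: bounded_mfun_prod => k; apply: bounded_mfunM => //; exact: bounded_mfun_prod.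
rewrite mean_sum; last first.
  by move=> f; apply: bounded_mfun_prod => k; apply: bounded_mfunM => //; exact: bounded_mfun_cst.
apply: eq_bigr => f _.
pose E := \bigcap_(k in [set: 'I_K]) (tau k @^-1` B (f k)).
have sE : process_sigma (fun k => tau k : T -> R) E.
  apply: process_sigma_bigcap; [exact: finite_finset|move=> k _].
  exact: (process_sigma_preimage (X := fun k : nat => tau k : T -> R) k (mB _)).
have mE : measurable E.
  apply: fin_bigcap_measurable; [exact: finite_finset|move=> k _].
  by rewrite -[X in measurable X]setTI; exact: mtau.
have EE w : \prod_(k < K) \1_(B (f k)) (tau k w) = \1_E w :> R.
  rewrite (@prod_indic_preimage R T R _ (fun k : 'I_K => tau k : T -> R)
    (index_enum 'I_K) (fun k => B (f k)) w).
  congr (\1_ _ w); apply/seteqP; split => v vJ k _; apply: vJ => //=.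
  by rewrite mem_index_enum.
have [_ [iS lS] _ indep] := hq.
have indepES (J : seq (nat * 'I_n)) (A : nat * 'I_n -> set R) :
    uniq J -> (forall i, measurable (A i)) ->
    P (E `&` \bigcap_(i in [set` J]) (S i @^-1` A i)) =
    (P E * \prod_(i <- J) P (S i @^-1` A i))%E.
  move=> uJ mA; rewrite indep//; first by rewrite iS.
  apply: process_sigma_bigcap; [exact: finite_seq|move=> p _].
  exact: (process_sigma_preimage (X := fun p => S p : T -> R) p (mA p)).
pose h (p : 'I_K * 'I_n) := (nat_of_ord p.1, p.2).
have injh : injective h by move=> [k l] [k' l'] [/val_inj -> ->].
have := @mean_prod_indep _ _ _ _ _ P _ (fun p => S (h p) : T -> R) E
  (fun p => mS (h p)) mE (product_rule_reindex injh indepES)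
  (index_enum ('I_K * 'I_n)%type) (fun p => age_presence (c (f p.1)))
  (index_enum_uniq _) (fun p => bounded_mfun_age_presence _)
  (fun p => age_presence_ge0 _).
have -> : (fun w => \1_E w * \prod_(p <- index_enum ('I_K * 'I_n)%type)
      age_presence (c (f p.1)) (S (h p) w)) =
   (fun w => \prod_(k < K) (\1_(B (f k)) (tau k w) *
      \prod_(l < n) age_presence (c (f k)) (S (nat_of_ord k, l) w))).
  apply/funext => w; rewrite big_split/= EE; congr (_ * _).
  by rewrite pair_big/=.
move=> ->.
have -> : \prod_(p <- index_enum ('I_K * 'I_n)%type)
    \int[P]_w age_presence (c (f p.1)) (S (h p) w) = \prod_(k < K) age_pgf (c (f k)).
  rewrite -(pair_bigA _ (fun k l => \int[P]_w age_presence (c (f k)) (S (nat_of_ord k, l) w)))/=.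
  apply: eq_bigr => k _; case: (c (f k)) => [u|] /=.
    rewrite -[n in RHS]card_ord -prodr_const; apply: eq_bigr => l _.
    by apply: mean_presence => //; exact: lS.
  by rewrite big1// => l _; rewrite mean_cst.
under [RHS]eq_Rintegral do rewrite big_split/= EE mulrC.
by rewrite meanZ ?mean_indic 1?mulrC//; exact: bounded_mfun_indic.
Qed.

End slots.

End batches.

Lemma cvg_finprod (R : realType) (I : Type) (s : seq I) (F : I -> nat -> R) (l : I -> R) :
  (forall i, F i K @[K --> \oo] --> l i) ->
  \prod_(i <- s) F i K @[K --> \oo] --> \prod_(i <- s) l i.
Proof.
move=> Fl; elim: s => [|i s IH].
  by rewrite big_nil; under eq_fun do rewrite big_nil; exact: cvg_cst.
by rewrite big_cons; under eq_fun do rewrite big_cons; exact: cvgM.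
Qed.

Section equal_slots.
Context {R : realType}.
Variables (delta : R) (m : nat).
Hypothesis delta0 : 0 < delta.

(** The complement of the window (0, m delta] is a slot too, so that every epoch
    lies in exactly one slot. *)
Definition slot (o : option 'I_m) : set R :=
  if o is Some i then `](i%:R * delta), (i.+1%:R * delta)]
  else ~` `]0, (m%:R * delta)].

Lemma measurable_slot o : measurable (slot o).
Proof.
by case: o => [i|] /=; [exact: measurable_itv|apply: measurableC; exact: measurable_itv].
Qed.

Lemma slot_exists x : exists o, slot o x.
Proof.
have [x0|nx] := pselect (0 < x <= m%:R * delta); last first.
  by exists None => /=; rewrite in_itv/=.
have /andP[x0' xm] := x0.
have ex : exists j, x <= j%:R * delta by exists m.
case: (ex_minnP ex) => -[|i] xi imin; first by move: xi; rewrite mul0r leNgt x0'.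
exists (Some (Ordinal (imin m xm))) => /=; rewrite in_itv/= xi andbT ltNge.
by apply/negP => /imin; rewrite ltnn.
Qed.

Lemma slot_inj x o o' : slot o x -> slot o' x -> o = o'.
Proof.
have key (i j : 'I_m) : slot (Some i) x -> slot (Some j) x -> (i <= j)%N.
  rewrite /= !in_itv/= => /andP[ix _] /andP[_ xj].
  by rewrite -ltnS -(ltr_nat R) -(ltr_pM2r delta0) (lt_le_trans ix).
have key' (i : 'I_m) : slot (Some i) x -> slot None x -> False.
  rewrite /= !in_itv/= => /andP[ix xi]; apply.
  rewrite (le_lt_trans _ ix) ?mulr_ge0 ?(ltW delta0)//= (le_trans xi)//.
  by rewrite ler_wpM2r ?(ltW delta0)// ler_nat.
case: o o' => [i|] [j|]// si sj.
- by congr Some; apply/val_inj/eqP; rewrite eqn_leq !key.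
- by case: (key' _ si sj).
- by case: (key' _ sj si).
Qed.

Lemma sum_slot x o (F : option 'I_m -> R) : slot o x ->
  \sum_(p : option 'I_m) \1_(slot p) x * F p = F o.
Proof.
move=> so; rewrite (bigD1 o)//= indicE mem_set// mul1r big1 ?addr0// => p po.
rewrite indicE memNset ?mul0r// => sp.
by move/eqP: po; apply; exact: slot_inj sp so.
Qed.

(** Regroups a product over batches by slots, the exponents becoming counts. *)
Lemma prod_slot x o (p : option 'I_m -> R) : slot o x -> p None = 1 ->
  p o = \prod_(i < m) p (Some i) ^+ (i%:R * delta < x <= i.+1%:R * delta)%R.
Proof.
move=> so p1.
have sE (i : 'I_m) : (i%:R * delta < x <= i.+1%:R * delta)%R = (Some i == o).
  apply/idP/eqP => [si|oi]; last by move: so; rewrite -oi /= in_itv.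
  by apply: (@slot_inj x) => //=; rewrite in_itv.
under eq_bigr do rewrite sE.
case: o so sE => [i|] so sE; last by rewrite p1 big1.
rewrite (bigD1 i)//= eqxx expr1 big1 ?mulr1// => j ji.
by rewrite (_ : Some j == Some i = false)//; apply/negbTE; apply: contra ji => /eqP[->].
Qed.

End equal_slots.

Section batches.
Context d (T : measurableType d) (R : realType) (P : probability T R).
Variables (lambda : R) (n : nat) (G : probability R R).
Variables (tau : nat -> {RV P >-> R}) (S : nat * 'I_n -> {RV P >-> R}).
Hypothesis hq : batch_queue lambda G tau S.
Hypothesis lambda0 : 0 < lambda.
Variable z : R.
Hypothesis z01 : 0 < z < 1.

Let z01' : 0 <= z <= 1. Proof. by case/andP: z01 => /ltW -> /ltW ->. Qed.
Let mtau k : measurable_fun setT (tau k). Proof. exact: measurable_funP. Qed.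
Let mS p : measurable_fun setT (S p). Proof. exact: measurable_funP. Qed.

Lemma measurable_arrivals s t : measurable_fun setT (arrivals (fun k => tau k : T -> R) s t).
Proof.
rewrite (_ : arrivals _ _ _ =
    fun w => (\sum_(k <oo) ((s < tau k w <= t)%R : nat)%:R%:E)%E); last first.
  by apply/funext => w; rewrite /arrivals -counting_series.
apply: (@measurable_counting_series _ _ _ (fun k w => (s < tau k w <= t)%R : nat)) => k.
rewrite (_ : (fun w => _) = \1_(tau k @^-1` `]s, t])).
  by apply: measurable_indic; rewrite -[X in measurable X]setTI; apply: mtau.
apply/funext => w; rewrite indicE; congr ((nat_of_bool _)%:R).
by apply/idP/idP; rewrite inE/= in_itv.
Qed.

Lemma age_pgf_bnd a : 0 < age_pgf n G z a <= 1.
Proof.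
have [z0 z1] := andP z01; case: a => [u|] /=; last by rewrite ltr01 lexx.
have /andP[a b] := customer_pgf_bnd G u z01'.
have c0 := lt_le_trans z0 a.
by rewrite exprn_gt0//= exprn_ile1// ltW.
Qed.

(** After averaging over the services, the product over the first K batches is a
    product over slots of powers whose exponents are numbers of arrivals; these
    increase with K to independent Poisson counts. *)
Lemma slots_limit (delta : R) (m : nat) (c : option 'I_m -> option R) :
  0 < delta -> c None = None ->
  \int[P]_w (\prod_(k < K) \sum_(o : option 'I_m) \1_(slot delta o) (tau k w) *
      \prod_(l < n) age_presence z (c o) (S (nat_of_ord k, l) w)) @[K --> \oo] -->
  \prod_(i < m) expR (- (lambda * delta * (1 - age_pgf n G z (c (Some i))))).
Proof.
move=> delta0 cN.
have [[_ arr iarr] _ _ _] := hq.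
(* the increments are indexed by all naturals, so [p] is extended by 1 *)
pose p (i : nat) : R := if insub i is Some j then age_pgf n G z (c (Some j)) else 1.
have pE (i : 'I_m) : p i = age_pgf n G z (c (Some i)).
  by rewrite /p valK.
have p01 i : 0 < p i <= 1.
  by rewrite /p; case: insub => [j|]; rewrite ?ltr01 ?lexx//; exact: age_pgf_bnd.
pose A i := arrivals (fun k => tau k : T -> R) (i%:R * delta) (i.+1%:R * delta).
have mA i : measurable_fun setT (A i) by exact: measurable_arrivals.
have id0 i : 0 <= i%:R * delta by rewrite mulr_ge0// ltW.
have idS i : i%:R * delta <= i.+1%:R * delta by rewrite ler_wpM2r ?(ltW delta0)// ler_nat.
have lA i : has_law P (A i) (Pois (lambda * delta)%:E).
  have := arr _ _ (id0 i) (idS i).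
  by rewrite -mulrBl -natrB// subSnn mul1r.
have ld0 : 0 <= lambda * delta by rewrite mulr_ge0// ltW.
have EK K : \int[P]_w (\prod_(k < K) \sum_(o : option 'I_m) \1_(slot delta o) (tau k w) *
      \prod_(l < n) age_presence z (c o) (S (nat_of_ord k, l) w)) =
    \int[P]_w \prod_(i < m) \prod_(k < K) p i ^+ (i%:R * delta < tau k w <= i.+1%:R * delta)%R.
  rewrite (mean_slots hq z01' c K (@measurable_slot _ delta m)).
  apply: eq_Rintegral => w _; rewrite exchange_big/=; apply: eq_bigr => k _.
  have [q so] := slot_exists delta m (tau k w).
  rewrite (sum_slot delta0 _ so) (prod_slot (p := fun o => age_pgf n G z (c o)) delta0 so) ?cN//.
  by apply: eq_bigr => i _; rewrite pE.
under eq_fun do rewrite EK.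
have -> : \prod_(i < m) expR (- (lambda * delta * (1 - age_pgf n G z (c (Some i))))) =
    \int[P]_w \prod_(i <- index_iota 0 m) epow (p i) (A i w).
  have := @mean_prod_indep _ _ _ _ _ P _ A setT mA measurableT _ (index_iota 0 m)
    (fun i => epow (p i)) (iota_uniq _ _).
  rewrite probability_setT mul1r => H.
  transitivity (\int[P]_w (\1_[set: T] w *
      \prod_(i <- index_iota 0 m) epow (p i) (A i w))); last first.
    by apply: eq_Rintegral => w _; rewrite indicT mul1r.
  rewrite H.
  - rewrite big_mkord; apply: eq_bigr => i _.
    rewrite (Pois_pgf _ _ (p01 i) _ (lA i))//; [|by right].
    rewrite -EFinM epow_ge0E; last by rewrite lee_fin mulr_ge0// subr_ge0; case/andP: (p01 i).
    by rewrite pE /powR gt_eqF ?expR_gt0// expRK mulrN1.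
  - by move=> J B uJ mB; rewrite setTI mul1e iarr// mul0r.
  - by move=> i; apply: bounded_mfun_epow; case/andP: (p01 i) => /ltW -> ->.
  - by move=> i x; exact: epow_ge0.
apply: (@mean_cvg _ _ _ _ _ _ 1).
- move=> K; apply: measurable_prod => i _; apply: measurable_prod => k _.
  rewrite (_ : (fun w => _) = (fun w => 1 - (1 - p i) *
      \1_(tau k @^-1` `](i%:R * delta), (i.+1%:R * delta)]) w)).
    apply: measurable_funB => //; apply: measurable_funM => //.
    by apply: measurable_indic; rewrite -[X in measurable X]setTI; apply: mtau.
  apply/funext => w; rewrite indicE.
  case: (boolP (i%:R * delta < tau k w <= i.+1%:R * delta)%R) => h.
    by rewrite mem_set/= ?in_itv//= expr1 mulr1 subKr.
  by rewrite memNset/= ?in_itv/= ?expr0 ?mulr0 ?subr0//; exact/negP.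
- apply: (bounded_mfun_prod _ _).1 => i; apply: bounded_mfun_comp (mA i) _.
  by apply: bounded_mfun_epow; case/andP: (p01 i) => /ltW -> ->.
- move=> K w.
  have h : 0 <= \prod_(i < m) \prod_(k < K)
      p i ^+ (i%:R * delta < tau k w <= i.+1%:R * delta)%R <= 1.
    have q01 (i : 'I_m) : 0 <= \prod_(k < K)
        p i ^+ (i%:R * delta < tau k w <= i.+1%:R * delta)%R <= 1.
      have [p0 p1] := andP (p01 i).
      rewrite prodr_ge0 => [|k _]; last by rewrite exprn_ge0// ltW.
      by apply: prodr_ile1 => k _; rewrite exprn_ge0 ?exprn_ile1 ?(ltW p0).
    rewrite prodr_ge0 => [|i _]; last by case/andP: (q01 i).
    exact: prodr_ile1.
  by case/andP: h => h0 h1; rewrite ger0_norm.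
- have : \forall w \ae P, forall i : 'I_m, exists k : nat, A i w = k%:R%:E.
    by apply: filter_forall => i; exact: Pois_ae_nat (lA i).
  apply: filterS => w Aw; rewrite big_mkord.
  apply: cvg_finprod => i.
  have := @epow_series R (p i) (fun k => (i%:R * delta < tau k w <= i.+1%:R * delta)%R) (p01 i).
  rewrite -counting_series -/(arrivals (fun k => tau k : T -> R) _ _ w) -/(A i w).
  by apply; right; have [k ->] := Aw i.
Qed.

End batches.

(** * Riemann sums of a monotone function *)

Section riemann_sums.
Context {R : realType}.
Variable h : R -> R.
Hypotheses (h01 : forall u, 0 <= h u <= 1) (h_ni : {homo h : u v / u <= v >-> v <= u}).
Local Open Scope ereal_scope.

Let mu := @lebesgue_measure R.

Let mh : measurable_fun setT (EFin \o h).
Proof.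
by apply/measurable_EFinP; apply: nonincreasing_measurable => // u v uv; exact: h_ni.
Qed.

Let h0 u : 0 <= (h u)%:E.
Proof. by rewrite lee_fin; case/andP: (h01 u). Qed.

Let mhD (D : set R) : measurable_fun D (EFin \o h).
Proof. exact: measurable_funTS mh. Qed.

Lemma integral_slice_bounds (a b : R) : (a <= b)%R ->
  ((b - a) * h b)%:E <= \int[mu]_(u in `[a, b[) (h u)%:E <= ((b - a) * h a)%:E.
Proof.
move=> ab.
have muab : mu `[a, b[%classic = (b - a)%:E.
  rewrite /mu lebesgue_measure_itv/= lte_fin.
  by move: ab; rewrite le_eqVlt => /orP[/eqP ->|->]; rewrite ?ltxx ?subrr ?EFinB.
have cst c : \int[mu]_(u in `[a, b[) (cst c%:E u) = ((b - a) * c)%:E.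
  transitivity (c%:E * mu `[a, b[%classic); first exact: integral_cst.
  by rewrite muab -EFinM mulrC.
rewrite -!cst; apply/andP; split; apply: ge0_le_integral => //; try exact: mhD.
- by move=> u _; exact: h0.
- by move=> u /=; rewrite in_itv/= => /andP[_ ub]; rewrite lee_fin h_ni// ltW.
- by move=> u /=; rewrite in_itv/= => /andP[au _]; rewrite lee_fin h_ni.
Qed.

Lemma integral_between_riemann_sums (delta : R) m : (0 < delta)%R ->
  (delta * \sum_(v < m) h (v.+1%:R * delta))%:E <=
  \int[mu]_(u in `[0%R, (m%:R * delta)%R[) (h u)%:E <=
  (delta * \sum_(v < m) h (v%:R * delta))%:E.
Proof.
move=> d0; elim: m => [|m /andP[IHl IHu]].
  by rewrite !big_ord0 mulr0 mul0r set_itvco0 integral_set0 lexx.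
have s0 k : (0 <= k%:R * delta :> R)%R by rewrite mulr_ge0// ltW.
have sS : (m%:R * delta <= m.+1%:R * delta)%R.
  by rewrite ler_wpM2r ?(ltW d0)// ler_nat.
rewrite (@itv_bndbnd_setU _ _ _ (BLeft (m%:R * delta)%R)) ?bnd_simp//.
rewrite ge0_integral_setU//; first last.
- apply/disj_setPRL => u /=; rewrite !in_itv/= => /andP[mu1 _] /andP[_].
  by rewrite ltNge mu1.
- exact: mhD.
have /andP[l u] := integral_slice_bounds sS.
have dE : (m.+1%:R * delta - m%:R * delta = delta)%R.
  by rewrite -mulrBl -natrB// subSnn mul1r.
rewrite dE in l u.
by rewrite !big_ord_recr/= !mulrDr !EFinD leeD//= leeD.
Qed.

Lemma integral_fin (t : R) : (0 <= t)%R ->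
  \int[mu]_(u in `[0%R, t[) (h u)%:E \is a fin_num.
Proof.
move=> t0; have /andP[_ u] := integral_slice_bounds t0.
by rewrite ge0_fin_numE ?(le_lt_trans u) ?ltry//; apply: integral_ge0.
Qed.

(** For a monotone function the lower and upper sums differ by a telescoping
    sum, here at most [delta]. *)
Lemma riemann_error (t : R) m (delta := (t / m.+1%:R)%R) : (0 < t)%R ->
  let J := fine (\int[mu]_(u in `[0%R, t[) (h u)%:E) in
  (J - delta <= delta * \sum_(v < m.+1) h (v.+1%:R * delta))%R /\
  (delta * \sum_(v < m.+1) h (v%:R * delta) <= J + delta)%R.
Proof.
move=> t0 J.
have d0 : (0 < delta)%R by rewrite divr_gt0.
have tE : (m.+1%:R * delta = t)%R by rewrite /delta mulrC divfK.
have := @integral_between_riemann_sums delta m.+1 d0; rewrite tE.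
rewrite -(fineK (integral_fin (ltW t0))) !lee_fin -/J => /andP[l u].
have tel : (\sum_(v < m.+1) h (v%:R * delta) =
    \sum_(v < m.+1) h (v.+1%:R * delta) + (h 0 - h (m.+1%:R * delta)))%R.
  by rewrite big_ord_recl [in RHS]big_ord_recr/= mul0r; ring.
have e1 : (h 0 - h (m.+1%:R * delta) <= 1)%R.
  have /andP[a b] := h01 0; have /andP[a' b'] := h01 (m.+1%:R * delta).
  lra.
split; move: u l; rewrite tel; nra.
Qed.

Lemma integral_cvg_pinfty :
  \int[mu]_(u in `[0%R, k%:R[) (h u)%:E @[k --> \oo] -->
  \int[mu]_(u in `[0%R, +oo[) (h u)%:E.
Proof.
have -> : `[0%R, +oo[%classic = \bigcup_k `[0%R, k%:R : R[%classic.
  apply/seteqP; split => u /=; rewrite in_itv/= ?andbT.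
    move=> u0; exists (Num.truncn u).+1 => //=.
    by rewrite in_itv/= u0 truncnS_gt.
  by move=> [k _ /=]; rewrite in_itv/= => /andP[].
apply: ge0_nondecreasing_set_cvg_integral => //.
- move=> i j ij; apply/subsetPset => u /=; rewrite !in_itv/= => /andP[-> ui].
  by rewrite (lt_le_trans ui)// ler_nat.
- by move=> i; exact: mhD.
Qed.

End riemann_sums.

(** * The generating function of the number in system *)

Section queue.
Context d (T : measurableType d) (R : realType) (P : probability T R).
Variables (lambda : R) (n : nat) (G : probability R R).
Variables (tau : nat -> {RV P >-> R}) (S : nat * 'I_n -> {RV P >-> R}).
Hypothesis hq : batch_queue lambda G tau S.
Hypothesis lambda0 : 0 < lambda.

Let mtau k : measurable_fun setT (tau k). Proof. exact: measurable_funP. Qed.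
Let mS p : measurable_fun setT (S p). Proof. exact: measurable_funP. Qed.
Let Q := number_in_system (fun k => tau k : T -> R) (fun p => S p : T -> R).

Let N t k w := (\sum_(l < n) (tau k w <= t < tau k w + S (k, l) w)%R)%N.

Let QE t w : Q t w = (\sum_(k <oo) (N t k w)%:R%:E)%E.
Proof. exact: (counting_pair_series (fun p => (tau p.1 w <= t < tau p.1 w + S p w)%R)). Qed.

Let mN t k : measurable_fun setT (fun w => (N t k w)%:R : R).
Proof.
rewrite (_ : (fun w => _) = fun w => \sum_(l < n)
    \1_([set w | tau k w <= t] `&` [set w | t < tau k w + S (k, l) w]) w); last first.
  apply/funext => w; rewrite natr_sum; apply: eq_bigr => l _.
  rewrite indicE; congr ((nat_of_bool _)%:R).
  by apply/idP/idP; rewrite inE/=; [move=> /andP[]|move=> -[-> ->]].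
apply: measurable_sum => l; apply: measurable_indic; apply: measurableI.
- rewrite -[X in measurable X]setTI; apply: measurable_fun_le => //.
- rewrite (_ : [set w | _] = ~` [set w | tau k w + S (k, l) w <= t]).
    apply: measurableC; rewrite -[X in measurable X]setTI.
    by apply: measurable_fun_le => //; exact: measurable_funD.
  by apply/seteqP; split => w /=; rewrite ltNge => /negP.
Qed.

Lemma measurable_number_in_system t : measurable_fun setT (Q t).
Proof.
rewrite (_ : Q t = fun w => (\sum_(k <oo) (N t k w)%:R%:E)%E).
  exact: measurable_counting_series.
by apply/funext => w; exact: QE.
Qed.

Section pgf.
Variable z : R.
Hypothesis z01 : 0 < z < 1.

Let z01' : 0 <= z <= 1. Proof. by case/andP: z01 => /ltW -> /ltW ->. Qed.

Let bN t K : bounded_mfun (fun w => \prod_(k < K) z ^+ N t k w).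
Proof.
split; last first.
  exists 1 => w; rewrite ger0_norm.
    by apply: prodr_ile1 => k _; case/andP: z01' => a b; rewrite exprn_ge0 ?exprn_ile1.
  by rewrite prodr_ge0// => k _; rewrite exprn_ge0//; case/andP: z01'.
apply: measurable_prod => k _.
under eq_fun do rewrite -powR_mulrn ?(andP z01').1//.
by apply: (@measurableT_comp _ _ _ _ _ _ (powR z)) => //; exact: measurable_powRr.
Qed.

Let pgf_truncated t :
  \int[P]_w (\prod_(k < K) z ^+ N t k w) @[K --> \oo] --> \int[P]_w epow z (Q t w).
Proof.
apply: (@mean_cvg _ _ _ _ _ _ 1).
- by move=> K; exact: (bN t K).1.
- apply: measurableT_comp (measurable_number_in_system t).
  exact: (bounded_mfun_epow z01').1.
- move=> K w; rewrite ger0_norm.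
    by apply: prodr_ile1 => k _; case/andP: z01' => a b; rewrite exprn_ge0 ?exprn_ile1.
  by rewrite prodr_ge0// => k _; rewrite exprn_ge0//; case/andP: z01'.
- apply: aeW => w; rewrite QE; apply: epow_series; last by left; case/andP: z01.
  by case/andP: z01 => -> /ltW ->.
Qed.

Let presence_nd u v x : u <= v -> presence z u x <= presence z v x.
Proof.
rewrite /presence => uv; have /andP[_ z1] := z01'.
by case: (ltP v x) => [vx|_]; [rewrite (le_lt_trans uv vx)|case: ifP].
Qed.

Section sandwich.
Variables (t : R) (m : nat).
Hypothesis t0 : 0 < t.
Let delta := t / m.+1%:R.
Let d0 : 0 < delta. Proof. by rewrite divr_gt0. Qed.
Let dE : m.+1%:R * delta = t. Proof. by rewrite /delta mulrC divfK. Qed.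

(** The ages of a batch, seen at [t], at the right and the left end of its slot.
    Younger batches have more customers present, so [lo] gives the lower bound
    for z^N. *)
Let lo (o : option 'I_m.+1) := if o is Some i then Some (t - i.+1%:R * delta) else None.
Let hi (o : option 'I_m.+1) := if o is Some i then Some (t - i%:R * delta) else None.

Let D (c : option 'I_m.+1 -> option R) K w := \prod_(k < K) \sum_(o : option 'I_m.+1)
  \1_(slot delta o) (tau k w) *
      \prod_(l < n) age_presence z (c o) (S (nat_of_ord k, l) w).

Let bD c K : bounded_mfun (D c K).
Proof.
apply: bounded_mfun_prod => k; apply: bounded_mfun_sum => o; apply: bounded_mfunM.
  by apply: (bounded_mfun_comp (mtau k)); apply: bounded_mfun_indic; exact: measurable_slot.
apply: bounded_mfun_prod => l; apply: (bounded_mfun_comp (mS _)).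
exact: bounded_mfun_age_presence.
Qed.

(** Almost surely all epochs are positive, so a batch outside of (0, t] has not
    arrived yet and contributes no customer. *)
Let D_sandwich K : \forall w \ae P,
  D lo K w <= \prod_(k < K) z ^+ N t k w <= D hi K w.
Proof.
have [[taup _ _] _ _ _] := hq; apply: filterS taup => w taup.
have [z0 z1] := andP z01'.
have ge0 c (k : 'I_K) (q : option 'I_m.+1) : slot delta q (tau k w) ->
    0 <= \sum_(o : option 'I_m.+1) \1_(slot delta o) (tau k w) *
      \prod_(l < n) age_presence z (c o) (S (nat_of_ord k, l) w).
  move=> sq; rewrite (sum_slot d0
    (fun o => \prod_(l < n) age_presence z (c o) (S (nat_of_ord k, l) w)) sq).
  apply: prodr_ge0 => l _.
  exact: age_presence_ge0.
have key (k : 'I_K) :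
    \sum_(o : option 'I_m.+1) \1_(slot delta o) (tau k w) *
      \prod_(l < n) age_presence z (lo o) (S (nat_of_ord k, l) w) <= z ^+ N t k w <=
    \sum_(o : option 'I_m.+1) \1_(slot delta o) (tau k w) *
      \prod_(l < n) age_presence z (hi o) (S (nat_of_ord k, l) w).
  have [q sq] := slot_exists delta m.+1 (tau k w).
  rewrite (sum_slot d0 (fun o => \prod_(l < n) age_presence z (lo o) (S (nat_of_ord k, l) w)) sq).
  rewrite (sum_slot d0 (fun o => \prod_(l < n) age_presence z (hi o) (S (nat_of_ord k, l) w)) sq).
  rewrite /N expr_sum.
  suff H l : age_presence z (lo q) (S (nat_of_ord k, l) w) <=
      z ^+ (tau k w <= t < tau k w + S (nat_of_ord k, l) w)%R <=
      age_presence z (hi q) (S (nat_of_ord k, l) w).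
    apply/andP; split; apply: ler_prod => l _; have /andP[a b] := H l.
      by rewrite age_presence_ge0.
    by rewrite exprn_ge0.
  case: q sq => [i|] sq.
    move: sq; rewrite /= in_itv/= => /andP[it ti].
    have tt : tau k w <= t.
      by rewrite (le_trans ti)// -dE ler_wpM2r ?(ltW d0)// ler_nat.
    have -> : z ^+ (tau k w <= t < tau k w + S (nat_of_ord k, l) w)%R =
        presence z (t - tau k w) (S (nat_of_ord k, l) w).
      by rewrite /presence tt/= ltrBlDl; case: ifP.
    by rewrite !presence_nd// lerB// ltW.
  move: sq; rewrite /= in_itv/= dE => sq.
  rewrite (_ : (_ <= t < _) = false) ?expr0 ?lexx//.
  apply/negbTE/negP => /andP[tt _]; apply: sq; rewrite tt andbT.
  by case/andP: (taup k).
apply/andP; split; apply: ler_prod => k _; have /andP[a b] := key k.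
  have [q sq] := slot_exists delta m.+1 (tau k w).
  by rewrite (ge0 _ _ _ sq).
by rewrite exprn_ge0.
Qed.

Let mean_D_cvg c : c None = None -> \int[P]_w D c K w @[K --> \oo] -->
  \prod_(i < m.+1) expR (- (lambda * delta * (1 - age_pgf n G z (c (Some i))))).
Proof. by move=> cN; apply: slots_limit. Qed.

(** The slots are numbered from the past to [t], the ages from [t] to the past;
    the sums are reversed accordingly. *)
Lemma pgf_sandwich :
  expR (- (lambda * (delta * \sum_(v < m.+1) batch_loss G z n (v%:R * delta)))) <=
  \int[P]_w epow z (Q t w) <=
  expR (- (lambda * (delta * \sum_(v < m.+1) batch_loss G z n (v.+1%:R * delta)))).
Proof.
apply/andP; split.
- rewrite (_ : expR _ = \prod_(i < m.+1)
      expR (- (lambda * delta * (1 - age_pgf n G z (lo (Some i)))))).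
    apply: (ler_cvg_to (mean_D_cvg (c := lo) erefl) (@pgf_truncated t)).
    apply: nearW => K; apply: mean_le => //.
    by apply: filterS (D_sandwich K) => w /andP[].
  rewrite -expR_sum mulrA big_distrr/= -sumrN; congr expR.
  rewrite (reindex_inj rev_ord_inj)/=; apply: eq_bigr => i _.
  rewrite /batch_loss; congr (- (_ * (1 - customer_pgf G z _ ^+ n))).
  by rewrite natrB// mulrBl dE.
- rewrite (_ : expR _ = \prod_(i < m.+1)
      expR (- (lambda * delta * (1 - age_pgf n G z (hi (Some i)))))).
    apply: (ler_cvg_to (@pgf_truncated t) (mean_D_cvg (c := hi) erefl)).
    apply: nearW => K; apply: mean_le => //.
    by apply: filterS (D_sandwich K) => w /andP[].
  rewrite -expR_sum mulrA big_distrr/= -sumrN; congr expR.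
  rewrite (reindex_inj rev_ord_inj)/=; apply: eq_bigr => i _.
  rewrite /batch_loss; congr (- (_ * (1 - customer_pgf G z _ ^+ n))).
  have im : (i <= m)%N by rewrite -ltnS.
  by rewrite subSS -subSn// natrB ?(leq_trans im)// mulrBl dE.
Qed.

End sandwich.

Lemma pgf_number_in_system t : 0 < t ->
  \int[P]_w epow z (Q t w) = expR (- (lambda *
    fine (\int[@lebesgue_measure R]_(u in `[0%R, t[) (batch_loss G z n u)%:E)%E)).
Proof.
move=> t0; set J := fine _.
have h01 u := batch_loss_bnd G n u z01'.
have hni := @batch_loss_ni R G z n z01'.
have dcv (c : R) : expR (- (lambda * (J + c * (t / m.+1%:R)))) @[m --> \oo] -->
    expR (- (lambda * J)).
  have H : - (lambda * (J + c * (t / m.+1%:R))) @[m --> \oo] --> - (lambda * (J + c * t * 0)).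
    apply: cvgN; apply: cvgM; first exact: cvg_cst.
    apply: cvgD; first exact: cvg_cst.
    under eq_fun do rewrite mulrA.
    by apply: cvgM; [exact: cvg_cst|exact: cvg_harmonic].
  by rewrite mulr0 addr0 in H; exact: (cvg_comp _ _ H (@continuous_expR R _)).
apply/eqP; rewrite eq_le; apply/andP; split.
- apply: (ler_cvg_to (cvg_cst _) (dcv (-1))); apply: nearW => m.
  have /andP[_ u] := pgf_sandwich m t0; apply: (le_trans u).
  have [r _] := riemann_error h01 hni m t0.
  by rewrite ler_expR lerN2 ler_wpM2l ?(ltW lambda0)// mulN1r.
- apply: (ler_cvg_to (dcv 1) (cvg_cst _)); apply: nearW => m.
  have /andP[u _] := pgf_sandwich m t0; apply: (le_trans _ u).
  have [_ r] := riemann_error h01 hni m t0.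
  by rewrite ler_expR lerN2 ler_wpM2l ?(ltW lambda0)// mul1r.
Qed.

(** Along the integers the limit is the monotone convergence of the exponents; it
    extends to real times because the generating function decreases in time. *)
Lemma pgf_limit :
  \int[P]_w epow z (Q t w) @[t --> +oo] --> epow (expR (-1)) (lambda%:E *
    \int[@lebesgue_measure R]_(u in `[0%R, +oo[) (batch_loss G z n u)%:E)%E.
Proof.
have h01 u := batch_loss_bnd G n u z01'.
have hni := @batch_loss_ni R G z n z01'.
pose J t := (\int[@lebesgue_measure R]_(u in `[0%R, t[) (batch_loss G z n u)%:E)%E.
have J0 t : (0 <= J t)%E.
  by apply: integral_ge0 => u _; rewrite lee_fin; case/andP: (h01 u).
have e01 : 0 < expR (-1 : R) < 1 by rewrite expR_gt0 -[ltRHS]expR0 ltr_expR ltrN10.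
have QJ t : 0 < t -> \int[P]_w epow z (Q t w) = epow (expR (-1)) (lambda%:E * J t)%E.
  move=> t0; rewrite pgf_number_in_system// -/(J t).
  have Jf : J t \is a fin_num by exact: (integral_fin h01 hni (ltW t0)).
  rewrite (_ : lambda%:E * J t = (lambda * fine (J t))%:E)%E; last first.
    by rewrite EFinM fineK.
  rewrite epow_ge0E; last first.
    by rewrite lee_fin mulr_ge0 ?(ltW lambda0)// fine_ge0.
  by rewrite /powR gt_eqF ?expR_gt0// expRK mulrN1.
have QJnd s t : 0 < s -> s <= t ->
    \int[P]_w epow z (Q t w) <= \int[P]_w epow z (Q s w).
  move=> s0 st; rewrite !pgf_number_in_system//; last exact: lt_le_trans st.
  rewrite ler_expR lerN2 ler_wpM2l ?(ltW lambda0)// fine_le//.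
  - exact: (integral_fin h01 hni (ltW s0)).
  - exact: (integral_fin h01 hni (ltW (lt_le_trans s0 st))).
  - apply: ge0_subset_integral => //.
    + apply/measurable_EFinP; apply: measurable_funTS.
      exact: measurable_batch_loss.
    + by move=> u _; rewrite lee_fin; case/andP: (h01 u).
    + by move=> u /=; rewrite !in_itv/= => /andP[-> us]; rewrite (lt_le_trans us).
set l := epow _ _.
have cvk : \int[P]_w epow z (Q k.+1%:R w) @[k --> \oo] --> l.
  have ce : epow (expR (-1)) (lambda%:E * J k%:R)%E @[k --> \oo] --> l.
    have H : (lambda%:E * J k%:R)%E @[k --> \oo] --> (lambda%:E *
        \int[@lebesgue_measure R]_(u in `[0%R, +oo[) (batch_loss G z n u)%:E)%E.
      by apply: cvgeZl => //; exact: (integral_cvg_pinfty h01 hni).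
    apply: (cvg_comp _ _ H); apply: epow_continuous.
      by case/andP: e01 => -> /ltW ->.
    by left; case/andP: e01.
  rewrite -(cvg_shiftS (fun k : nat => epow (expR (-1)) (lambda%:E * J k%:R)%E)) in ce.
  apply: cvg_trans ce; apply: near_eq_cvg; apply: nearW => k /=.
  by rewrite QJ.
have lQ t : 0 < t -> l <= \int[P]_w epow z (Q t w).
  move=> t0; apply: (ler_cvg_to cvk (cvg_cst _)).
  near=> k; apply: QJnd; first exact: t0.
  have tk : ((Num.truncn t).+1 <= k)%N by near: k; exact: nbhs_infty_ge.
  apply: (le_trans (ltW (truncnS_gt t))).
  by rewrite ler_nat (leq_trans tk).
apply/cvgrPdist_lt => e e0.
move/cvgrPdist_lt: cvk => /(_ e e0)[K _ /(_ K (leqnn _))/= HK].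
exists K.+1%:R; split; first exact: num_real.
move=> t Kt; have t0 : 0 < t by rewrite (lt_trans _ Kt).
have K0 : 0 < K.+1%:R :> R by [].
rewrite distrC ger0_norm ?subr_ge0 ?lQ//.
have lK := lQ _ K0.
rewrite distrC ger0_norm in HK; last by rewrite subr_ge0; exact: lK.
apply: le_lt_trans HK; rewrite lerD2r; apply: QJnd; first exact: K0.
exact: ltW.
Unshelve. all: by end_near. Qed.

End pgf.
End queue.

(** * The weighted sum of Poisson variables *)

Lemma natinfD (R : realType) (x y : \bar R) : natinf x -> natinf y -> natinf (x + y)%E.
Proof.
move=> [->|[j ->]] [->|[k ->]]; [by left..|].
by right; exists (j + k)%N; rewrite natrD.
Qed.

Lemma natinf_sum (R : realType) (I : Type) (s : seq I) (F : I -> \bar R) :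
  (forall i, natinf (F i)) -> natinf (\sum_(i <- s) F i)%E.
Proof.
move=> F0; elim: s => [|i s IH]; first by rewrite big_nil; right; exists 0%N.
by rewrite big_cons; exact: natinfD.
Qed.

Lemma natinfM (R : realType) k (x : \bar R) : (0 < k)%N -> natinf x ->
  natinf (k%:R%:E * x)%E.
Proof.
move=> k0 [->|[j ->]]; first by left; rewrite gt0_muley// lte_fin ltr0n.
by right; exists (k * j)%N; rewrite natrM EFinM.
Qed.

Lemma natinf_ge0 (R : realType) (x : \bar R) : natinf x -> (0 <= x)%E.
Proof. by move=> [->|[k ->]]//; rewrite lee_fin. Qed.

Section weighted_poisson_sum.
Context d (T : measurableType d) (R : realType) (P : probability T R) (n : nat).
Variables (Y : 'I_n -> {RV P >-> \bar R}) (a : 'I_n -> \bar R).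
Hypothesis Yindep : mutually_independent P (fun j => Y j : T -> \bar R).
Hypothesis a0 : forall j, (0 <= a j)%E.
Hypothesis Ylaw : forall j, has_law P (Y j) (Pois (a j)).

Let mY j : measurable_fun setT (Y j). Proof. exact: measurable_funP. Qed.
Let Z w := (\sum_(j < n) (n - j)%N%:R%:E * Y j w)%E.

Let nY : \forall w \ae P, forall j, natinf (Y j w).
Proof.
apply: filter_forall => j; exact: (Pois_ae_natinf (mY j) (a0 j) (Ylaw j)).
Qed.

Let nj0 (j : 'I_n) : (0 < n - j)%N. Proof. by rewrite subn_gt0. Qed.

Lemma measurable_weighted_sum : measurable_fun setT Z.
Proof.
by apply: emeasurable_sum => j; exact: measurable_funeM.
Qed.

Lemma weighted_sum_ae_natinf : \forall w \ae P, natinf (Z w).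
Proof.
by apply: filterS nY => w nYw; apply: natinf_sum => j; exact: natinfM.
Qed.

Lemma pgf_weighted_sum z : 0 < z < 1 ->
  \int[P]_w epow z (Z w) =
  epow (expR (-1)) (\sum_(j < n) a j * (1 - z ^+ (n - j))%:E)%E.
Proof.
move=> /andP[z0 z1].
have zj (j : 'I_n) : 0 < z ^+ (n - j) < 1.
  by rewrite exprn_gt0//= exprn_ilt1// -?lt0n ?ltW.
have zj01 (j : 'I_n) : 0 <= z ^+ (n - j) <= 1.
  by have /andP[/ltW -> /ltW ->] := zj j.
have bY (j : 'I_n) : bounded_mfun (epow (z ^+ (n - j))) by exact: bounded_mfun_epow.
rewrite epow_sum ?expR_gt0//; last first.
  by move=> j; rewrite mule_ge0// lee_fin subr_ge0; case/andP: (zj01 j).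
transitivity (\int[P]_w (\1_[set: T] w * \prod_(j < n) epow (z ^+ (n - j)) (Y j w))).
  apply: mean_ae_eq.
  - apply: measurableT_comp measurable_weighted_sum.
    by apply: (bounded_mfun_epow _).1; rewrite !ltW.
  - apply: (bounded_mfunM (bounded_mfun_indic R measurableT) _).1.
    by apply: bounded_mfun_prod => j; exact: (bounded_mfun_comp (mY j)).
  - apply: filterS nY => w nYw; rewrite indicT mul1r epow_sum//; last first.
      by move=> j; apply: natinf_ge0; exact: natinfM.
    by apply: eq_bigr => j _; rewrite epow_scale//; exact: natinf_ge0.
rewrite (@mean_prod_indep _ _ _ _ _ P _ (fun j => Y j : T -> \bar R) setT mY measurableT _
  (index_enum 'I_n) (fun j => epow (z ^+ (n - j))) (index_enum_uniq _) bY)//; first last.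
- by move=> j x; exact: epow_ge0.
- by move=> J A uJ mA; rewrite setTI probability_setT mul1e; exact: Yindep.
rewrite probability_setT mul1r; apply: eq_bigr => j _.
apply: Pois_pgf => //.
- by have /andP[-> /ltW ->] := zj j.
- by left; case/andP: (zj j).
Qed.

End weighted_poisson_sum.

Theorem theorem2p11 (R : realType) (lambda : R) (hlambda : 0 < lambda)
  (n : nat) (hn : (0 < n)%N) (G : probability R R)
  (* the queue *)
  (d : measure_display) (T : measurableType d) (P : probability T R)
  (tau : nat -> {RV P >-> R}) (S : nat * 'I_n -> {RV P >-> R})
  (hqueue : batch_queue lambda G tau S)
  (* an i.i.d. sample of size n from G *)
  (d1 : measure_display) (T1 : measurableType d1) (P1 : probability T1 R)
  (X : 'I_n -> {RV P1 >-> R})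
  (hX : iid P1 (fun i => X i : T1 -> R) G)
  (* the Poisson variables; Y j stands for Y_(j+1) *)
  (d2 : measure_display) (T2 : measurableType d2) (P2 : probability T2 R)
  (Y : 'I_n -> {RV P2 >-> \bar R})
  (hYindep : mutually_independent P2 (fun j => Y j : T2 -> \bar R))
  (hYlaw : forall j : 'I_n, has_law P2 (Y j)
     (Pois (lambda%:E *
        'E_P1[(fun w => order_stat X j.+1 w - order_stat X j w)%R])%E)) :
  let Q := number_in_system tau S in
  let Z := fun w : T2 => (\sum_(j < n) (n - j)%N%:R%:E * Y j w)%E in
  cvg_in_law P Q P2 Z /\
  (forall (d3 : measure_display) (T3 : measurableType d3)
     (P3 : probability T3 R) (Qoo : {RV P3 >-> \bar R}),
     cvg_in_law P Q P3 Qoo -> equal_in_law P3 Qoo P2 Z).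
Proof.
move=> Q Z.
have G0 := bq_services_ge0 hqueue.
pose a (j : 'I_n) := (lambda%:E *
  'E_P1[(fun w => order_stat X j.+1 w - order_stat X j w)%R])%E.
have gap0 := expectation_gap_ge0 hX G0.
have a0 j : (0 <= a j)%E by rewrite mule_ge0// lee_fin ltW.
have mZ : measurable_fun setT Z by exact: measurable_weighted_sum.
have mQ t : measurable_fun setT (Q t) by exact: measurable_number_in_system.
have QZ : cvg_in_law P Q P2 Z.
  apply: cvg_in_law_pgf => //.
  - by move=> t w; exact: counting_natinf.
  - exact: weighted_sum_ae_natinf a0 hYlaw.
  - move=> z z01; rewrite (pgf_weighted_sum hYindep a0 hYlaw z01).
    rewrite (_ : (\sum_(j < n) _)%E = (lambda%:E *
      \int[@lebesgue_measure R]_(u in `[0%R, +oo[) (batch_loss G z n u)%:E)%E).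
      exact: pgf_limit.
    have /andP[z0 z1] := z01.
    rewrite (integral_batch_loss hX G0) ?(ltW z0) ?(ltW z1)//.
    rewrite ge0_sume_distrr.
      by apply: eq_bigr => j _; rewrite /a -muleA; congr (_ * _)%E; exact: muleC.
    move=> j _; rewrite mule_ge0// lee_fin subr_ge0.
    by rewrite exprn_ile1// ltW.
split=> // d3 T3 P3 Qoo QQoo.
apply: equal_in_law_continuous => // f cf f01.
have bf : bounded_mfun f.
  split; first exact: continuous_ereal_measurable.
  by exists 1 => x; have /andP[f0 f1] := f01 x; rewrite ger0_norm.
have bdf : [bounded f x | x in [set: \bar R]].
  exists 1; split; first exact: num_real.
  move=> M M1 x _ /=; have /andP[f0 f1] := f01 x.
  by rewrite ger0_norm// (le_trans f1)// ltW.
have c1 := QQoo f cf bdf; have c2 := QZ f cf bdf.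
have := cvg_unique (@ereal_hausdorff R) c1 c2.
rewrite (bounded_mfun_expectation P3 (bounded_mfun_comp (measurable_funP Qoo) bf)).
rewrite (bounded_mfun_expectation P2 (bounded_mfun_comp mZ bf)).
by move=> H; exact: (EFin_inj (H (fmap_proper_filter _ _))).
Qed.
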